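(* Let ${\mathscr X}$ be a Hausdorff space and ${\mathscr A}$ a set of finite Borel partitions of ${\mathscr X}$, directed under refinement, which resolves ${\mathscr X}$. Equip $M^1({\mathscr X})$ with the weak topology and assume the minimal conditions hold. Let $(\Pi_\alpha)_{\alpha\in{\mathscr A}}$ be a coherent system of Borel probability measures on the simplices $M^1({\mathscr X}_\alpha)$. Then there exists a unique Radon probability measure $\Pi$ on $M^1({\mathscr X})$ (weak topology) projecting to $\Pi_\alpha$ for every $\alpha\in{\mathscr A}$ if and only if there is a $Q\in M^1({\mathscr X})$ such that for every $\epsilon,\delta>0$ there is an $L>0$ with $$\Pi_\alpha\bigl(\{P_\alpha\in M^1({\mathscr X}_\alpha):\|P_\alpha-P_\alpha\wedge LQ_\alpha\|_{1,\alpha}>\delta\}\bigr)<\epsilon\quad\text{for all }\alpha\in{\mathscr A}.$$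
   Context: Partition: finite collection of non-empty disjoint Borel sets covering ${\mathscr X}$; $\alpha\le\beta$ iff $\beta$ refines $\alpha$; ${\mathscr A}$ resolves ${\mathscr X}$ if the sets in its partitions generate the Borel $\sigma$-algebra. $M^1({\mathscr X})$: Radon probability measures on ${\mathscr X}$; weak topology: coarsest making $P\mapsto\int h\,dP$ continuous for all bounded Borel $h$. Minimal conditions: ${\mathscr X}$ and $M^1({\mathscr X})$ are Hausdorff, ${\mathscr A}$ is a directed set of finite Borel partitions, and $P\mapsto P(A)$ is Borel measurable on $M^1({\mathscr X})$ for every $A\in\alpha\in{\mathscr A}$. For $\alpha\in{\mathscr A}$, $M^1({\mathscr X}_\alpha)$ is the simplex of probability vectors $(p_A)_{A\in\alpha}$; the projection is $P\mapsto P_\alpha=(P(A))_{A\in\alpha}$; for $\alpha\le\beta$ the transition map $\varphi_{\alpha\beta}:M^1({\mathscr X}_\beta)\to M^1({\mathscr X}_\alpha)$ is $(\varphi_{\alpha\beta}p)_A=\sum_{B\in\beta,B\subset A}p_B$. The system is coherent if $\Pi_\alpha=\Pi_\beta\circ\varphi_{\alpha\beta}^{-1}$ whenever $\alpha\le\beta$. $\Pi$ projects to $\Pi_\alpha$ if $\Pi_\alpha$ is the law of $P_\alpha$ under $P\sim\Pi$. $P_\alpha\wedge LQ_\alpha$ is the componentwise minimum and $\|\cdot\|_{1,\alpha}$ the $\ell^1$-norm over $A\in\alpha$. *)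

(* Defs.v *)
From HB Require Import structures.
From mathcomp Require Import all_boot all_order all_algebra.
From mathcomp Require Import all_classical all_reals all_analysis.
Set Implicit Arguments. Unset Strict Implicit. Unset Printing Implicit Defensive.
Import Order.TTheory GRing.Theory Num.Theory.
Local Open Scope classical_set_scope.
Local Open Scope ring_scope.

Section Defs.
Variables (X : ptopologicalType) (R : realType).

Definition mX := g_sigma_algebraType (@open X).

Definition Meas := probability mX R.

Definition radonX (P : Meas) : Prop :=
  forall B : set mX, measurable B ->
    P B = ereal_sup [set P (K : set mX) | K in [set K : set X | compact K /\ K `<=` B]].

Definition M1 : set Meas := [set P | radonX P].

(* two representatives denote the same measure iff they agree on Borel sets *)
Definition same_meas (P Q : Meas) : Prop :=
  forall B : set mX, measurable B -> P B = Q B.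

Definition bounded_borel (h : X -> R) : Prop :=
  measurable_fun [set: mX] (h : mX -> R) /\ exists M : R, forall x, `|h x| <= M.

Definition integ (P : Meas) (h : X -> R) : R :=
  fine (\int[P]_(x in [set: mX]) (h x)%:E)%E.

(* weak topology on M^1(X): coarsest topology making P |-> int h dP
   continuous for all bounded Borel h; open sets written via the
   basic neighbourhoods generated by this subbasis *)
Definition weak_open (O : set Meas) : Prop :=
  O `<=` M1 /\
  forall P, O P -> exists (n : nat) (h : 'I_n -> X -> R) (e : R),
    [/\ 0 < e, (forall i, bounded_borel (h i)) &
        [set Q | M1 Q /\ forall i, `|integ Q (h i) - integ P (h i)| < e] `<=` O].

Definition weak_hausdorff : Prop :=
  forall P Q, M1 P -> M1 Q -> ~ same_meas P Q ->
    exists O1 O2, [/\ weak_open O1, weak_open O2, O1 P, O2 Q & O1 `&` O2 = set0].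

Definition weak_compact (K : set Meas) : Prop :=
  K `<=` M1 /\
  forall (I : Type) (U : I -> set Meas), (forall i, weak_open (U i)) ->
    K `<=` \bigcup_i U i ->
    exists D : set I, finite_set D /\ K `<=` \bigcup_(i in D) U i.

Definition M1_borel : set (set Meas) := <<s M1, weak_open >>.

Definition prob_on (T : Type) (D : set T) (S : set (set T)) (mu : set T -> \bar R)
  : Prop :=
  [/\ mu set0 = 0%E, (forall A, S A -> (0 <= mu A)%E),
      (forall F : nat -> set T, (forall n, S (F n)) -> trivIset setT F ->
         (fun n => \sum_(0 <= k < n) mu (F k))%E @ \oo --> mu (\bigcup_n F n))
    & mu D = 1%E].

Definition radon_on_M1 (Pi : set Meas -> \bar R) : Prop :=
  prob_on M1 M1_borel Pi /\
  forall B, M1_borel B ->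
    Pi B = ereal_sup [set Pi K | K in [set K | weak_compact K /\ K `<=` B]].

Definition finite_borel_partition (a : set (set X)) : Prop :=
  [/\ finite_set a,
      (forall A, a A -> A !=set0 /\ measurable (A : set mX)),
      (forall A B, a A -> a B -> A <> B -> A `&` B = set0)
    & \bigcup_(A in a) A = setT].

(* a <= b : b refines a *)
Definition refines (a b : set (set X)) : Prop :=
  forall B, b B -> exists A, a A /\ B `<=` A.

Definition directed_refine (Al : set (set (set X))) : Prop :=
  Al !=set0 /\
  forall a b, Al a -> Al b -> exists c, [/\ Al c, refines a c & refines b c].

Definition resolves (Al : set (set (set X))) : Prop :=
  <<s [set A | exists2 a, Al a & a A] >> = <<s @open X >>.

Definition simplex (a : set (set X)) : set (set X -> R) :=
  [set p | [/\ forall A, ~ a A -> p A = 0,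
               forall A, a A -> 0 <= p A &
               \sum_(A \in a) p A = 1]].

Definition simplex_open (a : set (set X)) (O : set (set X -> R)) : Prop :=
  O `<=` simplex a /\
  forall p, O p -> exists e : R, 0 < e /\
    [set q | simplex a q /\ forall A, a A -> `|q A - p A| < e] `<=` O.

Definition simplex_borel (a : set (set X)) : set (set (set X -> R)) :=
  <<s simplex a, simplex_open a >>.

Definition projM (a : set (set X)) (P : Meas) : set X -> R :=
  fun A => if A \in a then fine (P A) else 0.

Definition transition (a b : set (set X)) (p : set X -> R) : set X -> R :=
  fun A => if A \in a then \sum_(B \in [set B | b B /\ B `<=` A]) p B else 0.

Definition coherent (Al : set (set (set X)))
  (Pia : set (set X) -> set (set X -> R) -> \bar R) : Prop :=
  forall a b, Al a -> Al b -> refines a b ->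
    forall B, simplex_borel a B ->
      Pia a B = Pia b [set p | simplex b p /\ B (transition a b p)].

Definition projects_to (Al : set (set (set X)))
  (Pi : set Meas -> \bar R) (Pia : set (set X) -> set (set X -> R) -> \bar R)
  : Prop :=
  forall a, Al a -> forall B, simplex_borel a B ->
    Pia a B = Pi [set P | M1 P /\ B (projM a P)].

Definition minimal_conditions (Al : set (set (set X))) : Prop :=
  [/\ hausdorff_space X, weak_hausdorff,
      directed_refine Al, (forall a, Al a -> finite_borel_partition a) &
      (forall a A, Al a -> a A -> forall U : set R, measurable U ->
         M1_borel [set P | M1 P /\ U (fine (P A))])].

Definition l1_excess (a : set (set X)) (L : R) (p q : set X -> R) : R :=
  \sum_(A \in a) `|p A - Num.min (p A) (L * q A)|.

End Defs.

(* Main.v *)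
Require Import Defs.
From HB Require Import structures.
From mathcomp Require Import all_boot all_order all_algebra.
From mathcomp Require Import finmap all_classical all_reals all_analysis.
From mathcomp Require Import measurable_realfun lra.
Import Order.TTheory GRing.Theory Num.Theory.
Import numFieldNormedType.Exports.
Local Open Scope classical_set_scope.
Local Open Scope ring_scope.

(* Necessity. Dini's theorem on a weakly compact set [K] of measures shows that [K] is
   uniformly absolutely continuous with respect to a countable mixture of its elements.
   Mixing over compact sets exhausting the Radon measure [Pi] gives [Q]: uniformly on a
   compact set of large mass, [P (\bigcup {A | P A > L Q A})] is small for large [L], and
   it bounds the excess.

   Sufficiency. With [L_n] attached to [eps 2^-(n+1)] and [2^-n], the set [H] of measures
   satisfying [P <= L_n Q + 2^-n] for all [n] is weakly compact: by Tychonoff in the space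
   of set functions, where the bounds turn finite additivity into countable additivity
   and Radonness. A vector [p] whose excesses obey the same bounds lifts to
   [sum_A p_A Q(. | A)], which lies in [H]; so the contents of open cylinders are tight
   with respect to such sets [H]. The outer measure generated by this content measures
   all unions of open cylinders, hence, as compact sets are closed for the coarser
   topology generated by cylinders, all weakly open sets.

   Uniqueness. Disjoint weakly compact sets are separated by an open cylinder, on which
   two solutions agree. *)

Set Implicit Arguments.
Unset Strict Implicit.
Unset Printing Implicit Defensive.

(** * Probabilities on a sigma-algebra of subsets of [D] *)

(** Two obstacles shape the argument. The weak topology tests every bounded Borel function, so its
    Borel sets may go far beyond what cylinders generate, and a monotone class argument cannot reach
    them. Hence an outer measure built from a lattice of open sets, whose measurable sets are
    enlarged afterwards by means of compactness and tightness. Moreover, elements of [Meas] also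
    carry values on non-Borel sets: one measure has many representatives, the weak topology does not
    separate them, and compact sets of representatives need be neither closed nor Borel. Hence
    [same_meas], [saturated], and estimates through inner regularity.

    The [L] of the criterion depends on [delta], and a single bound [P <= L Q + delta] leaves an
    error on small sets. Imposing the bounds for all [delta = 2^-n] at once yields one modulus of
    absolute continuity with respect to [Q], and the exceptional masses [eps 2^-(n+1)] still add up
    to [eps]. *)

Lemma ereal_fin_bounds {R : realType} (x : \bar R) :
  (0 <= x)%E -> (x <= 1)%E -> x = (fine x)%:E.
Proof. by case: x. Qed.

Section ProbOn.
Context {T : Type} {R : realType} {D : set T} {S : set (set T)}.
Context {mu : set T -> \bar R}.
Hypothesis mu_prob : prob_on D S mu.
Hypothesis S_sigma : sigma_algebra D S.
Hypothesis S_sub : forall A, S A -> A `<=` D.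

Let sigmaE : [/\ S D, setSD_closed S, ndseq_closed S & setI_closed S].
Proof. exact/(sigma_algebraP S_sub). Qed.

Lemma sigma_on_set0 : S set0. Proof. by case: S_sigma. Qed.
Lemma sigma_on_full : S D. Proof. by case: sigmaE. Qed.
Lemma sigma_on_setI A B : S A -> S B -> S (A `&` B).
Proof. by case: sigmaE => _ _ _; exact. Qed.
Lemma sigma_on_setU A B : S A -> S B -> S (A `|` B).
Proof.
move=> SA SB; rewrite -bigcup2E; case: S_sigma => S0 _; apply.
by case=> [|[|n]].
Qed.
Lemma sigma_on_setD A B : S A -> S B -> S (A `\` B).
Proof.
move=> SA SB; have -> : A `\` B = A `\` (A `&` B) by rewrite setDIr setDv set0U.
case: sigmaE => _ + _ _; apply => //.
exact: sigma_on_setI.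
Qed.

Lemma prob_on_ge0 A : S A -> (0 <= mu A)%E.
Proof. by case: mu_prob => _ + _ _; exact. Qed.

Lemma prob_on_full : mu D = 1%E. Proof. by case: mu_prob. Qed.
Lemma prob_on_set0 : mu set0 = 0%E. Proof. by case: mu_prob. Qed.

Lemma prob_onU A B : S A -> S B -> A `&` B = set0 ->
  mu (A `|` B) = (mu A + mu B)%E.
Proof.
move=> SA SB AB0; case: mu_prob => mu0 _ + _ => /(_ (bigcup2 A B)).
have SF n : S (bigcup2 A B n) by case: n => [|[|n]] //; exact: sigma_on_set0.
have tF : trivIset setT (bigcup2 A B).
  by apply/trivIsetP => -[|[|i]] [|[|j]] //= _ _ _; rewrite ?set0I ?setI0 // setIC.
rewrite bigcup2E => /(_ SF tF) h.
(* From index two on, the partial sums no longer change. *)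
move: h; rewrite -2!cvg_shiftS /= => h.
rewrite -(cvg_lim _ h) //; apply: lim_near_cst => //; near=> n.
by rewrite !big_nat_recl //= big1_seq ?adde0.
Unshelve. all: by end_near. Qed.

Lemma le_prob_on A B : S A -> S B -> A `<=` B -> (mu A <= mu B)%E.
Proof.
move=> SA SB AB; have SBA := sigma_on_setD SB SA.
by rewrite -(setDUK AB) prob_onU ?setDIK // leeDl // prob_on_ge0.
Qed.

Lemma prob_on_le1 A : S A -> (mu A <= 1)%E.
Proof.
by move=> SA; rewrite -prob_on_full le_prob_on//; [exact: sigma_on_full|exact: S_sub].
Qed.

Lemma prob_on_fin A : S A -> mu A = (fine (mu A))%:E.
Proof. by move=> SA; rewrite -ereal_fin_bounds ?prob_on_ge0 ?prob_on_le1. Qed.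

Lemma prob_on_fineU A B : S A -> S B -> A `&` B = set0 ->
  fine (mu (A `|` B)) = fine (mu A) + fine (mu B).
Proof.
by move=> SA SB AB0; rewrite prob_onU // (prob_on_fin SA) (prob_on_fin SB).
Qed.

Lemma prob_on_fine_ge0 A : S A -> 0 <= fine (mu A).
Proof. by move=> SA; rewrite fine_ge0 // prob_on_ge0. Qed.

Lemma le_prob_on_fine A B : S A -> S B -> A `<=` B -> fine (mu A) <= fine (mu B).
Proof.
by move=> SA SB AB; rewrite -lee_fin -!prob_on_fin // le_prob_on.
Qed.

Lemma prob_on_fineD A B : S A -> S B -> B `<=` A ->
  fine (mu (A `\` B)) = fine (mu A) - fine (mu B).
Proof.
move=> SA SB BA.
have SAB := sigma_on_setD SA SB.
by have := prob_on_fineU SB SAB (setDIK _ _); rewrite setDUK // => ->; lra.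
Qed.

Lemma prob_on_fineC A : S A -> fine (mu (D `\` A)) = 1 - fine (mu A).
Proof.
move=> SA; have SD := sigma_on_full.
by rewrite prob_on_fineD ?prob_on_full //; exact: S_sub.
Qed.


Lemma prob_on_fine_modular A B : S A -> S B ->
  fine (mu (A `|` B)) + fine (mu (A `&` B)) = fine (mu A) + fine (mu B).
Proof.
move=> SA SB.
have SAB := sigma_on_setI SA SB.
have SBA := sigma_on_setD SB SA.
have := prob_on_fineU SA SBA (setDIK _ _).
have -> : A `|` (B `\` A) = A `|` B.
  by apply/seteqP; split=> x /=; case: (pselect (A x)); tauto.
have : (A `&` B) `&` (B `\` A) = set0.
  by apply/seteqP; split=> x //= [[? ?] [? ?]].
move=> /(prob_on_fineU SAB SBA).
have -> : (A `&` B) `|` (B `\` A) = B.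
  by apply/seteqP; split=> x /=; case: (pselect (A x)); tauto.
by move=> -> -> ; lra.
Qed.

Lemma prob_on_cvg (F : (set T)^nat) : (forall n, S (F n)) ->
  {homo F : n m / (n <= m)%N >-> n `<=` m} ->
  (fine \o mu \o F) @ \oo --> fine (mu (\bigcup_n F n)).
Proof.
move=> SF ndF.
have ndF' : nondecreasing_seq F by move=> n m nm; apply/subsetPset; exact: ndF.
have SU : S (\bigcup_n F n) by case: S_sigma => _ _; exact.
have SD n : S (seqD F n).
  by case: n => [|n] /=; [exact: SF|exact: sigma_on_setD].
case: mu_prob => mu0 _ /(_ (seqD F) SD (trivIset_seqD ndF')) + _.
rewrite eq_bigcup_seqD => h.
have hE n : (\sum_(0 <= k < n.+1) mu (seqD F k))%E = mu (F n).
  elim: n => [|n IH]; first by rewrite big_nat1.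
  have SFD := SD n.+1.
  by rewrite big_nat_recr //= IH -prob_onU ?setDUK ?setDIK //; exact: ndF.
move: h; rewrite -cvg_shiftS /= => h.
have {}h : mu \o F @ \oo --> mu (\bigcup_n F n).
  by apply: cvg_trans h; apply: near_eq_cvg; near=> n; rewrite /= hE.
by move: h; rewrite (prob_on_fin SU) => /fine_cvgP [].
Unshelve. all: by end_near. Qed.

Lemma prob_on_approx (F : (set T)^nat) (e : R) : (forall n, S (F n)) ->
  {homo F : n m / (n <= m)%N >-> n `<=` m} -> 0 < e ->
  exists n, fine (mu (\bigcup_n F n)) - e < fine (mu (F n)).
Proof.
move=> SF ndF e0.
have /cvgrPdist_lt/(_ e e0)[N _ /(_ N (leqnn _))] := prob_on_cvg SF ndF.
by rewrite /= ltr_distlC => /andP[h _]; exists N.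
Qed.

Lemma prob_on_bigU_le (F : (set T)^nat) n : (forall n, S (F n)) ->
  fine (mu (\big[setU/set0]_(i < n) F i)) <= \sum_(i < n) fine (mu (F i)) /\
  S (\big[setU/set0]_(i < n) F i).
Proof.
move=> SF; elim: n => [|n [IH1 IH2]].
  by rewrite !big_ord0 prob_on_set0 /=; split=> //; exact: sigma_on_set0.
rewrite !big_ord_recr /=; split; last exact: sigma_on_setU.
have := prob_on_fine_modular IH2 (SF n).
have := prob_on_fine_ge0 (sigma_on_setI IH2 (SF n)).
by move: IH1; lra.
Qed.

End ProbOn.

(** Dynkin's argument: the sets of agreement form a lambda system, finiteness giving closure under
    proper differences and equal total mass giving [D]. *)
Lemma prob_on_unique (T : Type) (R : realType) (D : set T) (G : set (set T))
    (mu nu : set T -> \bar R) :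
  (forall A, G A -> A `<=` D) -> setI_closed G ->
  prob_on D <<s D, G >> mu -> prob_on D <<s D, G >> nu ->
  (forall A, G A -> mu A = nu A) -> forall A, <<s D, G >> A -> mu A = nu A.
Proof.
move=> GD GI pmu pnu GE.
have sD A : <<s D, G >> A -> A `<=` D.
  move=> /(_ [set A | A `<=` D]); apply; split => //; split => //.
  - by move=> B BD; exact: subDsetl.
  - by move=> F FD x [n _ /FD].
have sG : sigma_algebra D <<s D, G >> by exact: smallest_sigma_algebra.
pose H := [set A | <<s D, G >> A /\ mu A = nu A].
suff: <<s D, G >> `<=` H by move=> h A /h[].
apply: lambda_system_subset => //; last first.
  by move=> A GA; split; [exact: sub_sigma_algebra|exact: GE].
split.
- by move=> A [/sD].
- split; first exact: (sigma_on_full sG sD).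
  by rewrite (prob_on_full pmu) (prob_on_full pnu).
- move=> A B BA [sA eA] [sB eB]; have sAB := sigma_on_setD sG sD sA sB.
  split=> //.
  rewrite (prob_on_fin pmu) // (prob_on_fin pnu sG sD sAB) //.
  by rewrite (prob_on_fineD pmu) // (prob_on_fineD pnu sG sD sA sB BA) eA eB.
- move=> F ndF HF.
  have SF n : <<s D, G >> (F n) by case: (HF n).
  have ndF' : {homo F : n m / (n <= m)%N >-> n `<=` m}.
    by move=> n m nm; apply/subsetPset; exact: ndF.
  have SU : <<s D, G >> (\bigcup_n F n) by case: sG => _ _; exact.
  split=> //; rewrite (prob_on_fin pmu) // (prob_on_fin pnu sG sD SU) //.
  have E : fine \o mu \o F = fine \o nu \o F.
    by apply/funext => n /=; case: (HF n) => _ ->.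
  congr EFin; rewrite -(cvg_lim _ (prob_on_cvg pmu sG sD SF ndF')) // E.
  exact: (cvg_lim _ (prob_on_cvg pnu sG sD SF ndF')).
Qed.

(** * Extension of a tight content on a lattice of open sets *)

Section LatticeContentExtension.
Context {T : Type} {R : realType} {M : set T} {U : set (set T)}.
Context {nu : set T -> R}.

(** The topology on [M] with base [U]; [U] itself is only a lattice. *)
Definition union_open (O : set T) :=
  O `<=` M /\ forall x, O x -> exists A, [/\ U A, A x & A `<=` O].

Definition inner_content (O : set T) : R :=
  sup [set nu A | A in [set A | U A /\ A `<=` O]].

(** Only the trace of [E] on [M] has to be covered, so the outer measure lives on all of [set T] and
    vanishes off [M]. *)
Definition outer_content (E : set T) : R :=
  inf [set inner_content O | O in [set O | union_open O /\ E `&` M `<=` O]].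

Hypotheses (U_sub : forall A, U A -> A `<=` M) (U0 : U set0) (UM : U M).
Hypothesis UI : forall A B, U A -> U B -> U (A `&` B).
Hypothesis UU : forall A B, U A -> U B -> U (A `|` B).
Hypothesis nu_ge0 : forall A, U A -> 0 <= nu A.
Hypotheses (nu0 : nu set0 = 0) (nuM : nu M = 1).
Hypothesis le_nu : forall A B, U A -> U B -> A `<=` B -> nu A <= nu B.
Hypothesis nu_modular : forall A B, U A -> U B ->
  nu (A `|` B) + nu (A `&` B) = nu A + nu B.
(** Inner regularity by closed sets, stated within the lattice: the complement of [V] lies in [A]
    and has mass at least [nu A - e]. *)
Hypothesis nu_approx : forall A e, U A -> 0 < e ->
  exists V, [/\ U V, V `|` A = M & nu A + nu V <= 1 + e].

(** Along upward directed covers a finite subcover reduces to one member. [G] is a parameter because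
    both cylinders and weakly open sets will serve. *)
Definition directed_compact (G : set (set T)) (H : set T) :=
  forall F : set (set T), F `<=` G -> F !=set0 ->
    (forall A B, F A -> F B -> exists C, F C /\ A `|` B `<=` C) ->
    H `<=` \bigcup_(A in F) A -> exists A, F A /\ H `<=` A.

(** [H] need not be measurable in any sense, so its mass is gauged from outside by members of
    [U]. *)
Definition nearly_full (e : R) (H : set T) :=
  forall A, U A -> H `<=` A -> 1 - e <= nu A.

Hypothesis nu_tight : forall e, 0 < e ->
  exists H, [/\ H `<=` M, directed_compact U H & nearly_full e H].

Let nu_le1 A : U A -> nu A <= 1.
Proof. by move=> UA; rewrite -nuM le_nu //; exact: U_sub. Qed.

Let nuU_le A B : U A -> U B -> nu (A `|` B) <= nu A + nu B.
Proof.
by move=> UA UB; rewrite -nu_modular // lerDl nu_ge0 //; exact: UI.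
Qed.

Let inner_has_sup O : has_sup [set nu A | A in [set A | U A /\ A `<=` O]].
Proof.
split; first by exists (nu set0); exists set0 => //; split.
by exists 1 => _ [A [UA _] <-]; exact: nu_le1.
Qed.

Let le_inner A O : U A -> A `<=` O -> nu A <= inner_content O.
Proof.
by move=> UA AO; apply: (ub_le_sup (proj2 (inner_has_sup O))); exists A.
Qed.

Let inner_le O x : (forall A, U A -> A `<=` O -> nu A <= x) -> inner_content O <= x.
Proof.
move=> h; apply: ge_sup; first by case: (inner_has_sup O).
by move=> _ [A [UA AO] <-]; exact: h.
Qed.

Let inner_approx O e : 0 < e ->
  exists A, [/\ U A, A `<=` O & inner_content O - e < nu A].
Proof.
by move=> e0; have [_ [A [UA AO] <-] h] := sup_adherent e0 (inner_has_sup O); exists A.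
Qed.

Let inner_ge0 O : 0 <= inner_content O.
Proof. by rewrite -nu0 le_inner. Qed.

Let inner_le1 O : inner_content O <= 1.
Proof. by apply: inner_le => A UA _; exact: nu_le1. Qed.

Let inner_mono O O' : O `<=` O' -> inner_content O <= inner_content O'.
Proof.
move=> OO'; apply: inner_le => A UA AO; apply: le_inner => //.
exact: subset_trans OO'.
Qed.

Let inner_lattice A : U A -> inner_content A = nu A.
Proof.
move=> UA; apply/eqP; rewrite eq_le le_inner // andbT.
by apply: inner_le => B UB BA; exact: le_nu.
Qed.

Let opn_lattice A : U A -> union_open A.
Proof.
by move=> UA; split=> [|x Ax]; [exact: U_sub|exists A; split].
Qed.

Let opn_setI A B : union_open A -> union_open B -> union_open (A `&` B).
Proof.
move=> [AM oA] [BM oB]; split; first by move=> x [/AM].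
move=> x [/oA[A' [UA' A'x A'A]] /oB[B' [UB' B'x B'B]]].
exists (A' `&` B'); split=> //; first exact: UI.
exact: setISS.
Qed.

(** This is tau-smoothness. Completing [A] to [M] by [V] turns the cover of [A] into a directed
    cover of a compact [H]; one [V] united with [B] contains [H], so [1 - e/2 <= nu V + nu B], while
    [nu A + nu V <= 1 + e/2]. *)
Let nu_directed (F : set (set T)) A e : F `<=` U -> F !=set0 ->
    (forall A B, F A -> F B -> exists C, F C /\ A `|` B `<=` C) ->
    U A -> A `<=` \bigcup_(B in F) B -> 0 < e ->
  exists B, F B /\ nu A <= nu B + e.
Proof.
move=> FU [B0 FB0] dF UA AF e0; have e2 : 0 < e / 2 by lra.
have [V [UV VA hV]] := nu_approx UA e2.
have [H [HM cH tH]] := nu_tight e2.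
have [_ [[B FB <-] HB]] : exists C, [set V `|` B | B in F] C /\ H `<=` C.
  apply: cH.
  - by move=> _ [B FB <-]; apply: UU => //; exact: FU.
  - by exists (V `|` B0), B0.
  - move=> _ _ [B FB <-] [B' FB' <-]; have [C [FC BC]] := dF _ _ FB FB'.
    exists (V `|` C); split; first by exists C.
    move=> x [[xx|xx]|[xx|xx]]; [by left|right|by left|right].
      by apply: BC; left.
    by apply: BC; right.
  - move=> x /HM; rewrite -VA => -[Vx|/AF[B FB Bx]].
      by exists (V `|` B0); [exists B0|left].
    by exists (V `|` B); [exists B|right].
exists B; split=> //; have := tH _ (UU UV (FU _ FB)) HB.
by have := nuU_le UV (FU _ FB); lra.
Qed.

Let nu_bigU (W : (set T)^nat) n : (forall k, U (W k)) ->
  U (\big[setU/set0]_(k < n) W k) /\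
  nu (\big[setU/set0]_(k < n) W k) <= \sum_(k < n) nu (W k).
Proof.
move=> UW; elim: n => [|n [IH1 IH2]]; first by rewrite !big_ord0 nu0.
rewrite !big_ord_recr /=; split; first exact: UU.
by apply: (le_trans (nuU_le IH1 (UW n))); rewrite lerD2r.
Qed.

Let inner_bigcup (O : (set T)^nat) A e : (forall n, union_open (O n)) ->
  U A -> A `<=` \bigcup_n O n -> 0 < e ->
  exists n, nu A <= \sum_(k < n) inner_content (O k) + e.
Proof.
move=> oO UA AO e0.
(* Finite unions whose [k]-th piece lies inside [O k]: this family is directed, and its members are
   controlled term by term by the inner contents. *)
pose F := [set B | exists n (W : (set T)^nat),
  (forall k, U (W k) /\ W k `<=` O k) /\ B = \big[setU/set0]_(k < n) W k].
have : exists B, F B /\ nu A <= nu B + e.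
  apply: nu_directed => //.
  - move=> _ [n [W [hW ->]]]; apply: (proj1 (nu_bigU _ _)) => k.
    by case: (hW k).
  - exists (\big[setU/set0]_(k < 0) (fun=> set0) k), 0%N, (fun=> set0).
    by split=> // k; split.
  - move=> _ _ [n [W [hW ->]]] [m [W' [hW' ->]]].
    exists (\big[setU/set0]_(k < maxn n m) (W k `|` W' k)); split.
      exists (maxn n m), (fun k => W k `|` W' k); split=> // k.
      have [UW WO] := hW k; have [UW' WO'] := hW' k.
      by split; [exact: UU|rewrite subUset].
    rewrite -(bigcup_mkord n W) -(bigcup_mkord m W').
    rewrite -(bigcup_mkord (maxn n m) (fun k => W k `|` W' k)).
    move=> x [] [k /= kn Wx]; exists k => /=.
    + by rewrite leq_max kn.
    + by left.
    + by rewrite leq_max kn orbT.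
    + by right.
  - move=> x /AO [n _ /(proj2 (oO n))[B [UB Bx BO]]].
    exists (\big[setU/set0]_(k < n.+1) (if k == n :> nat then B else set0)).
      exists n.+1, (fun k => if k == n then B else set0); split=> // k.
      by case: eqP => [->|_]; split.
    rewrite -(bigcup_mkord n.+1 (fun k => if k == n then B else set0)).
    by exists n => /=; rewrite ?ltnSn // eqxx.
move=> [_ [[n [W [hW ->]]] h]]; exists n; apply: (le_trans h); rewrite lerD2r.
apply: (le_trans (proj2 (nu_bigU n (fun k => proj1 (hW k))))).
by apply: ler_sum => k _; case: (hW k) => ? ?; exact: le_inner.
Qed.

Let outer_has_inf E :
  has_inf [set inner_content O | O in [set O | union_open O /\ E `&` M `<=` O]].
Proof.
split; last by exists 0 => _ [G oG <-]; exact: inner_ge0.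
by exists (inner_content M), M => //; split; [exact: opn_lattice|exact: subIsetr].
Qed.

Let outer_le E O : union_open O -> E `&` M `<=` O -> outer_content E <= inner_content O.
Proof.
by move=> oO EO; have [_ lb] := outer_has_inf E; apply: (ge_inf lb); exists O.
Qed.

Let outer_ge E x : (forall O, union_open O -> E `&` M `<=` O -> x <= inner_content O) ->
  x <= outer_content E.
Proof.
move=> h; apply: lb_le_inf; first by case: (outer_has_inf E).
by move=> _ [G [oG EG] <-]; exact: h.
Qed.

Let outer_approx E e : 0 < e ->
  exists O, [/\ union_open O, E `&` M `<=` O & inner_content O < outer_content E + e].
Proof.
move=> e0; have [_ [G [oG EG] <-] h] := inf_adherent e0 (outer_has_inf E).
by exists G.
Qed.

Let outer_ge0 E : 0 <= outer_content E.
Proof. by apply: outer_ge => O _ _; exact: inner_ge0. Qed.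

Let outer_mono E E' : E `<=` E' -> outer_content E <= outer_content E'.
Proof.
move=> EE'; apply: outer_ge => O oO EO; apply: outer_le => //.
by apply: subset_trans EO; exact: setSI.
Qed.

Let outer_open O : union_open O -> outer_content O = inner_content O.
Proof.
move=> oO; apply/eqP; rewrite eq_le (outer_le oO (@subIsetl _ _ _)) /=.
apply: outer_ge => O' _ OO'; apply: inner_mono.
by move=> x Ox; apply: OO'; split=> //; case: oO => + _; exact.
Qed.

Let outer0 : outer_content set0 = 0.
Proof.
by rewrite outer_open ?inner_lattice //; exact: opn_lattice.
Qed.

Let sum_half e n : \sum_(k < n) e / 2 ^+ k.+1 = e * (1 - 1 / 2 ^+ n) :> R.
Proof.
elim: n => [|n IH]; first by rewrite big_ord0 expr0; lra.
rewrite big_ord_recr /= IH exprS invfM.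
by set x := _^-1; lra.
Qed.

Let outer_sigma_subadditive :
  sigma_subadditive (fun E : set T => (outer_content E)%:E).
Proof.
move=> E.
have mu0 k : (0 <= (outer_content (E k))%:E)%E by rewrite lee_fin.
apply/lee_addgt0Pr => e e0; have e2 : 0 < e / 2 by lra.
(* Half of [e] is spread over the sets [E k] as a geometric series; the other half pays for
   [inner_bigcup]. *)
have e2k (k : nat) : 0 < e / 2 / 2 ^+ k.+1 by rewrite divr_gt0 // exprn_gt0.
have /choice [ O hO] : forall k, exists O, [/\ union_open O, E k `&` M `<=` O &
    inner_content O < outer_content (E k) + e / 2 / 2 ^+ k.+1].
  by move=> k; exact: outer_approx.
apply: (@le_trans _ _ (inner_content (\bigcup_k O k))%:E).
  rewrite lee_fin; apply: outer_le.
    split; first by move=> x [k _]; case: (hO k) => -[+ _] _ _; exact.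
    move=> x [k _ Ox]; case: (hO k) => -[_ h] _ _.
    have [A [UA Ax AO]] := h _ Ox; exists A; split=> //.
    by apply: (subset_trans AO); exact: bigcup_sup.
  move=> x [[k _ Ex] Mx]; exists k => //.
  by case: (hO k) => _ h _; exact: h.
have key A : U A -> A `<=` \bigcup_k O k ->
    ((nu A)%:E <= \sum_(i <oo) (outer_content (E i))%:E + e%:E)%E.
  move=> UA AO; have [n hn] := inner_bigcup (fun k => let: And3 h _ _ := hO k in h) UA AO e2.
  apply: (@le_trans _ _ ((\sum_(k < n) outer_content (E k)) + e)%:E).
    rewrite lee_fin; apply: (le_trans hn).
    apply: (@le_trans _ _ (\sum_(k < n) (outer_content (E k) + e / 2 / 2 ^+ k.+1) + e / 2)).
      by rewrite lerD2r; apply: ler_sum => k _; case: (hO k) => _ _ /ltW.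
    rewrite big_split /= sum_half.
    have : 0 < 1 / 2 ^+ n :> R by rewrite divr_gt0 // exprn_gt0.
    set x := 1 / 2 ^+ n; move=> x0.
    have : 0 < e / 2 * x by rewrite mulr_gt0.
    by lra.
  rewrite EFinD leeD2r // -sumEFin.
  by rewrite -(big_mkord xpredT (fun k => (outer_content (E k))%:E)); exact: nneseries_lim_ge.
case E1 : (\sum_(i <oo) (outer_content (E i))%:E)%E key => [s||] key.
- rewrite -EFinD lee_fin; apply: inner_le => A UA AO.
  by have := key A UA AO; rewrite -EFinD lee_fin.
- by rewrite leey.
- have : (0 <= \sum_(i <oo) (outer_content (E i))%:E)%E by exact: nneseries_ge0.
  by rewrite E1.
Qed.

(** If [V] completes [A] inside [O], then a cover of [X] cut down to [V] still covers [X] off [O].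
    The overlap of [V] and [A] has content at most [e / 3], so modularity lets the contents of [A]
    and of any [W] inside [V] add up almost exactly. *)
Let outer_caratheodory O X : union_open O ->
  outer_content (X `&` O) + outer_content (X `&` ~` O) <= outer_content X.
Proof.
move=> oO; apply/ler_addgt0Pr => e e0; have e3 : 0 < e / 3 by lra.
have [G [oG XG hG]] := outer_approx X e3.
have oGO := opn_setI oG oO.
have [A [UA AGO hA]] := inner_approx (G `&` O) e3.
have [V [UV VA hV]] := nu_approx UA e3.
have oGV := opn_setI oG (opn_lattice UV).
have h1 : outer_content (X `&` O) <= inner_content (G `&` O).
  apply: outer_le => // x [[Xx Ox] Mx]; split=> //; exact: XG.
have h2 : outer_content (X `&` ~` O) <= inner_content (G `&` V).
  apply: outer_le => // x [[Xx nOx] Mx]; split; first exact: XG.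
  by move: Mx; rewrite -VA => -[//|/AGO[]].
have h3 : inner_content (G `&` V) <= inner_content G + e / 3 - nu A.
  apply: inner_le => W UW WGV.
  have := nu_modular UW UA.
  have : nu (W `|` A) <= inner_content G.
    apply: le_inner; first exact: UU.
    by rewrite subUset; split; [move=> x /WGV[]|move=> x /AGO[]].
  have : nu (W `&` A) <= nu (V `&` A).
    apply: le_nu; [exact: UI|exact: UI|].
    by apply: setSI => x /WGV[].
  have := nu_modular UV UA; rewrite VA nuM.
  by lra.
by lra.
Qed.

(** The result is delivered as an outer measure, not as a measure on the sigma-algebra generated by
    [U], so that measurability of further sets can still be tested. The last clause converts
    [nearly_full] into smallness of the complement as soon as that complement is open. *)
Theorem lattice_content_extension : exists mu : {outer_measure set T -> \bar R},
  [/\ (mu (~` M) = 0)%E,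
      forall A, U A -> mu A = (nu A)%:E,
      forall E e, 0 < e ->
        exists O, [/\ union_open O, E `&` M `<=` O & (mu O <= mu E + e%:E)%E],
      forall O, union_open O -> mu.-caratheodory O &
      (forall H e, H `<=` M -> nearly_full e H -> union_open (M `\` H) ->
        (mu (M `\` H) <= e%:E)%E) /\ forall E, (0 <= mu E <= 1)%E].
Proof.
pose m (E : set T) := (outer_content E)%:E.
have m0 : m set0 = 0%E by rewrite /m outer0.
have m_ge0 E : (0 <= m E)%E by rewrite lee_fin.
have m_mono : {homo m : A B / A `<=` B >-> (A <= B)%E}.
  by move=> A B AB; rewrite lee_fin; exact: outer_mono.
pose mB := isOuterMeasure.Build R T m m0 m_ge0 m_mono outer_sigma_subadditive.
pose mu : {outer_measure set T -> \bar R} := HB.pack m mB.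
exists mu; split.
- rewrite /= /m; congr EFin; apply/eqP; rewrite eq_le outer_ge0 andbT -nu0 -inner_lattice //.
  by apply: outer_le; [exact: opn_lattice|rewrite setICl].
- move=> A UA; rewrite /= /m outer_open ?inner_lattice //; exact: opn_lattice.
- move=> E e e0; have [ O [oO EO h]] := outer_approx E e0; exists O; split=> //.
  by rewrite /= /m -EFinD lee_fin outer_open // ltW.
- move=> O oO; apply: le_caratheodory_measurable => X.
  by rewrite /= /m -EFinD lee_fin; exact: outer_caratheodory.
- split; last first.
    move=> E; rewrite m_ge0 /= lee_fin.
    apply: (@le_trans _ _ (inner_content M)); last exact: inner_le1.
    by apply: outer_le; [exact: opn_lattice|exact: subIsetr].
  move=> H e HM tH oH; rewrite /= /m lee_fin outer_open //; apply: inner_le => A UA AH.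
  apply/ler_addgt0Pr => d d0; have [V [UV VA hV]] := nu_approx UA d0.
  have : 1 - e <= nu V.
    by apply: tH => // x Hx; have := HM _ Hx; rewrite -VA => -[//|/AH[]].
  by lra.
Qed.
End LatticeContentExtension.

(** * The weak topology through setwise neighbourhoods *)

Section WeakTopology.
Context {X : ptopologicalType} {R : realType}.
Implicit Types (P Q : Meas X R) (A B : set (mX X)).

Lemma meas_bounds P B : measurable B -> 0 <= fine (P B) <= 1.
Proof.
move=> mB; rewrite fine_ge0 ?measure_ge0 //= -[1]/(fine 1%:E).
by rewrite fine_le ?fin_num_measure // probability_le1.
Qed.

Lemma measE P B : measurable B -> P B = (fine (P B))%:E.
Proof. by move=> mB; rewrite fineK // fin_num_measure. Qed.

Lemma fine_measU P A B : measurable A -> measurable B -> A `&` B = set0 ->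
  fine (P (A `|` B)) = fine (P A) + fine (P B).
Proof. by move=> mA mB AB; rewrite measureU // fineD // fin_num_measure. Qed.

Lemma le_fine_meas P A B : measurable A -> measurable B -> A `<=` B ->
  fine (P A) <= fine (P B).
Proof.
move=> mA mB AB; rewrite fine_le ?fin_num_measure //.
by apply: le_measure; rewrite ?inE.
Qed.

Lemma fine_measT P : fine (P setT) = 1.
Proof. by rewrite probability_setT. Qed.

Lemma fine_measC P A : measurable A -> fine (P (~` A)) = 1 - fine (P A).
Proof.
move=> mA; rewrite -(fine_measT P) -(setUv A) fine_measU ?setICr //; first by lra.
exact: measurableC.
Qed.

Lemma fine_measD P A B : measurable A -> measurable B -> B `<=` A ->
  fine (P (A `\` B)) = fine (P A) - fine (P B).
Proof.
move=> mA mB BA; have mAB : measurable (A `\` B) by exact: measurableD.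
by have := fine_measU P mB mAB (setDIK _ _); rewrite setDUK // => ->; lra.
Qed.

Lemma integ_indic P B : measurable B -> integ P \1_B = fine (P B).
Proof.
by move=> mB; rewrite /integ integral_indic // setIT.
Qed.

Lemma bounded_borel_integrable P (h : X -> R) : bounded_borel h ->
  P.-integrable setT (EFin \o (h : mX X -> R)).
Proof.
move=> [mh [M hM]]; apply: measurable_bounded_integrable => //.
  exact: (le_lt_trans (@probability_le1 _ _ _ P setT measurableT) (ltey _)).
exists M; split; first exact: num_real.
by move=> x Mx y _ /=; apply: (le_trans (hM y)); exact: ltW.
Qed.

Lemma bounded_borel_indic B : measurable B -> bounded_borel (\1_B : X -> R).
Proof.
move=> mB; split; first exact/measurable_indicP.
by exists 1 => x; rewrite indicE; case: (_ \in _); rewrite /= ?normr0 ?normr1.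
Qed.

Lemma bounded_borelD (f g : X -> R) : bounded_borel f -> bounded_borel g ->
  bounded_borel (fun x => f x + g x).
Proof.
move=> [mf [M fM]] [mg [N gN]]; split; first exact: measurable_funD.
by exists (M + N) => x; rewrite (le_trans (ler_normD _ _)) // lerD.
Qed.

Lemma bounded_borelZ (c : R) (f : X -> R) : bounded_borel f ->
  bounded_borel (fun x => c * f x).
Proof.
move=> [mf [M fM]]; split; first exact: measurable_funM.
by exists (`|c| * M) => x; rewrite normrM ler_wpM2l.
Qed.

Lemma bounded_borel_cst (c : R) : bounded_borel (fun _ : X => c).
Proof. by split; [exact: measurable_cst|exists `|c|]. Qed.

Lemma integD P (f g : X -> R) : bounded_borel f -> bounded_borel g ->
  integ P (fun x => f x + g x) = integ P f + integ P g.
Proof.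
by move=> bf bg; exact: (RintegralD _ (bounded_borel_integrable P bf)
  (bounded_borel_integrable P bg)).
Qed.

Lemma integZ P (c : R) (f : X -> R) : bounded_borel f ->
  integ P (fun x => c * f x) = c * integ P f.
Proof.
by move=> bf; exact: (RintegralZl _ _ (bounded_borel_integrable P bf)).
Qed.

Lemma integ_cst P (c : R) : integ P (fun=> c) = c.
Proof.
rewrite /integ integral_cst // (_ : (_ * _)%E = c%:E) //.
by rewrite -[RHS]mule1; congr (_ * _)%E; exact: probability_setT.
Qed.

Lemma le_integ P (f g : X -> R) : bounded_borel f -> bounded_borel g ->
  (forall x, f x <= g x) -> integ P f <= integ P g.
Proof.
move=> bf bg fg; exact: (le_Rintegral _ (bounded_borel_integrable P bf)
  (bounded_borel_integrable P bg) (fun x _ => fg x)).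
Qed.

(** The sum counts the positive multiples of [eta], up to [N * eta], that do not exceed [f x]: [s]
    is [f] rounded down to the grid and truncated at [N * eta]. *)
Lemma staircase (f : X -> R) (eta : R) N x : 0 < eta -> 0 <= f x ->
  let s := eta * \sum_(k < N) \1_[set y | k.+1%:R * eta <= f y] x in
  (N%:R * eta <= f x /\ s = N%:R * eta) \/
  (f x < N%:R * eta /\ s <= f x < s + eta).
Proof.
move=> eta0 f0 /=; elim: N => [|N IH].
  by left; rewrite big_ord0 mulr0 mul0r.
rewrite big_ord_recr /= mulrDr indicE.
have E : N.+1%:R * eta = N%:R * eta + eta :> R by rewrite -natr1 mulrDl mul1r.
case: (leP (N.+1%:R * eta) (f x)) => h.
  rewrite mem_set //= mulr1; left; split=> //.
  by case: IH => [[_ ->]|[h1 _]]; rewrite E in h *; lra.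
rewrite memNset ?mulr0 ?addr0 /=; last by apply/negP; rewrite -ltNge.
right; split=> //.
by case: IH => [[h1 ->]|[_ //]]; rewrite E in h; lra.
Qed.

Lemma staircase_integ P (f : X -> R) (eta : R) N :
  measurable_fun setT (f : mX X -> R) ->
  let s x := eta * \sum_(k < N) \1_[set y | k.+1%:R * eta <= f y] x in
  bounded_borel s /\
  integ P s = eta * \sum_(k < N) fine (P [set y | k.+1%:R * eta <= f y]).
Proof.
move=> mf s.
have mB k : measurable ([set y | k.+1%:R * eta <= f y] : set (mX X)).
  rewrite -[X in measurable X]setTI.
  have -> : [set y | k.+1%:R * eta <= f y] = f @^-1` `[k.+1%:R * eta, +oo[.
    by apply/seteqP; split => x /=; rewrite in_itv /= andbT.
  exact: mf.
have : bounded_borel (fun x => \sum_(k < N) \1_[set y | k.+1%:R * eta <= f y] x : R) /\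
    integ P (fun x => \sum_(k < N) \1_[set y | k.+1%:R * eta <= f y] x) =
    \sum_(k < N) fine (P [set y | k.+1%:R * eta <= f y]).
  elim: N {s} => [|N [IH1 IH2]].
    under eq_fun do rewrite big_ord0.
    by rewrite big_ord0 integ_cst; split=> //; exact: bounded_borel_cst.
  under eq_fun do rewrite big_ord_recr /=.
  have bN := bounded_borel_indic (mB N).
  by rewrite big_ord_recr /= -IH2 -integ_indic // -integD //; split=> //; exact: bounded_borelD.
move=> [b <-]; split; first exact: bounded_borelZ.
by rewrite -integZ.
Qed.

(** After a shift making [h] nonnegative, the layers of its staircase are finitely many Borel sets,
    whose masses determine the integral up to the grid width [eta]. *)
Lemma integ_setwise (h : X -> R) (e : R) : bounded_borel h -> 0 < e ->
  exists (s : seq (set (mX X))) (d : R), [/\ 0 < d, (forall B, B \in s -> measurable B) &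
    forall P Q, (forall B, B \in s -> `|fine (Q B) - fine (P B)| < d) ->
      `|integ Q h - integ P h| < e].
Proof.
move=> bh e0; have [mh [M hM]] := bh.
pose eta := e / 4.
have eta0 : 0 < eta by rewrite /eta; lra.
pose f x := h x + M.
have bf : bounded_borel f by apply: bounded_borelD => //; exact: bounded_borel_cst.
have f0 x : 0 <= f x by have := hM x; rewrite /f ler_norml => /andP[]; lra.
pose N := (Num.truncn (2 * M / eta)).+1.
have fN x : f x < N%:R * eta.
  apply: (@le_lt_trans _ _ (2 * M)).
    by have := hM x; rewrite /f ler_norml => /andP[]; lra.
  by rewrite -ltr_pdivrMr // /N truncnS_gt.
pose B k : set (mX X) := [set y | k.+1%:R * eta <= f y].
have mf : measurable_fun setT (f : mX X -> R) by case: bf.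
(* [N] deviations below [1 / N] move the sum of layer masses by at most one, hence the integral of
   the staircase by at most [eta]; with the rounding error this gives [2 * eta], below
   [e = 4 * eta]. *)
exists [seq B k | k <- iota 0 N], (1 / N%:R); split.
- by rewrite divr_gt0 // ltr0n.
- move=> _ /mapP[k _ ->]; rewrite -[X in measurable X]setTI.
  have -> : B k = f @^-1` `[k.+1%:R * eta, +oo[.
    by apply/seteqP; split => x /=; rewrite in_itv /= andbT.
  exact: mf.
move=> P Q PQ.
have bnd P' : eta * (\sum_(k < N) fine (P' (B k))) <= integ P' h + M
    <= eta * (\sum_(k < N) fine (P' (B k))) + eta.
  have [bs <-] := staircase_integ P' eta N mf.
  have -> : integ P' h + M = integ P' f.
    by rewrite integD //; [rewrite integ_cst|exact: bounded_borel_cst].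
  have st x := staircase N eta0 (f0 x).
  apply/andP; split.
    by apply: le_integ => // x; case: (st x) => [[]|[]] /=; have := fN x; lra.
  rewrite -[X in _ <= _ + X](integ_cst P' eta) -integD //; last exact: bounded_borel_cst.
  apply: le_integ => //; first by apply: bounded_borelD => //; exact: bounded_borel_cst.
  by move=> x; case: (st x) => [[]|[]] /=; have := fN x; lra.
have dif : `|\sum_(k < N) fine (Q (B k)) - \sum_(k < N) fine (P (B k))| <= 1.
  rewrite -sumrB (le_trans (ler_norm_sum _ _ _)) //.
  apply: (@le_trans _ _ (\sum_(k < N) 1 / N%:R)).
    apply: ler_sum => k _; apply: ltW; apply: PQ; apply: map_f.
    by rewrite mem_iota /= add0n.
  by rewrite sumr_const card_ord -(mulr_natr (1 / N%:R)) divfK // pnatr_eq0.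
have := bnd P; have := bnd Q.
move: dif; set a := \sum_(k < N) _; set b := \sum_(k < N) _.
rewrite ler_distl ltr_distl => /andP[d1 d2] /andP[q1 q2] /andP[p1 p2].
have l1 : eta * a <= eta * b + eta.
  by rewrite -{3}[eta]mulr1 -mulrDr ler_wpM2l // ltW.
have l2 : eta * b <= eta * a + eta.
  rewrite -{3}[eta]mulr1 -mulrDr ler_wpM2l //; [exact: ltW|lra].
have ee : e = 4 * eta by rewrite /eta; lra.
by apply/andP; split; lra.
Qed.

Definition setwise_nbhs (P : Meas X R) (s : seq (set (mX X))) (d : R) :=
  [set Q | M1 Q /\ forall B, B \in s -> `|fine (Q B) - fine (P B)| < d].

Lemma weak_openP (O : set (Meas X R)) :
  weak_open O <-> O `<=` @M1 X R /\ forall P, O P -> exists s d,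
    [/\ 0 < d, (forall B, B \in s -> measurable B) & setwise_nbhs P s d `<=` O].
Proof.
split=> -[ OM oO]; split=> // P /oO.
- move=> [n [h [e [e0 bh sub]]]].
  have /choice[s] := fun i => integ_setwise (bh i) e0.
  move=> /choice[d hd].
  exists (flatten [seq s i | i <- enum 'I_n]), (\big[Num.min/1]_(i < n) d i).
  split.
  - by apply: lt_bigmin => // i _; case: (hd i).
  - by move=> B /flatten_mapP[i _ Bi]; case: (hd i) => _ + _; exact.
  - move=> Q [M1Q hQ]; apply: sub; split=> // i.
    case: (hd i) => _ _; apply => B Bs.
    apply: (@lt_le_trans _ _ (\big[Num.min/1]_(i < n) d i)); last exact: bigmin_le.
    by apply: hQ; apply/flatten_mapP; exists i; rewrite ?mem_enum.
- move=> [s [d [d0 ms sub]]].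
  exists (size s), (fun i => \1_(nth set0 s i)), d; split=> //.
  + by move=> i; apply: bounded_borel_indic; apply: ms; rewrite mem_nth.
  + move=> Q [M1Q hQ]; apply: sub; split=> // B Bs.
    have iB : (index B s < size s)%N by rewrite index_mem.
    have := hQ (Ordinal iB); rewrite /= nth_index // !integ_indic //; exact: ms.
Qed.

Lemma weak_open_sub O : weak_open O -> O `<=` @M1 X R.
Proof. by case. Qed.

Lemma weak_open_set0 : weak_open (set0 : set (Meas X R)).
Proof. by apply/weak_openP; split. Qed.

Lemma weak_open_M1 : weak_open (@M1 X R).
Proof.
by apply/weak_openP; split=> // P M1P; exists [::], 1; split=> // Q [].
Qed.

Lemma weak_open_bigcup (F : set (set (Meas X R))) :
  (forall O, F O -> weak_open O) -> weak_open (\bigcup_(O in F) O).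
Proof.
move=> oF; apply/weak_openP; split.
  by move=> P [ O /oF/weak_open_sub]; exact.
move=> P [ O FO OP]; have /weak_openP[_ /(_ P OP)[s [d [d0 ms sub]]]] := oF _ FO.
by exists s, d; split=> //; apply: (subset_trans sub) => Q OQ; exists O.
Qed.

Lemma weak_openU (O1 O2 : set (Meas X R)) :
  weak_open O1 -> weak_open O2 -> weak_open (O1 `|` O2).
Proof.
move=> oO1 oO2.
have -> : O1 `|` O2 = \bigcup_(O in [set O1; O2]) O.
  apply/seteqP; split=> P.
    by case=> ?; [exists O1 => //; left|exists O2 => //; right].
  by case=> O [->|->]; [left|right].
by apply: weak_open_bigcup => O [->|->].
Qed.

Lemma weak_open_lt B (c : R) : measurable B ->
  weak_open [set P : Meas X R | M1 P /\ fine (P B) < c].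
Proof.
move=> mB; apply/weak_openP; split=> [P []//|P [M1P hP]].
exists [:: B], (c - fine (P B)); split; first by rewrite subr_gt0.
  by move=> A; rewrite inE => /eqP ->.
move=> Q [M1Q /(_ B)]; rewrite mem_head ltr_distl => /(_ isT) /andP[_ h].
by split=> //; lra.
Qed.

Lemma same_meas_sym P Q : same_meas P Q -> same_meas Q P.
Proof. by move=> h B mB; rewrite h. Qed.

(** Setwise neighbourhoods look at Borel sets only, so representatives of one measure are
    topologically indistinguishable. *)
Lemma weak_open_same_meas (O : set (Meas X R)) P Q : weak_open O ->
  same_meas P Q -> M1 Q -> O P -> O Q.
Proof.
move=> /weak_openP[_ oO] PQ M1Q /oO[s [d [d0 ms sub]]]; apply: sub; split=> //.
by move=> B /ms mB; rewrite PQ // subrr normr0.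
Qed.

Lemma M1_borel_same_meas (O : set (Meas X R)) P Q : M1_borel O ->
  same_meas P Q -> M1 P -> M1 Q -> O P -> O Q.
Proof.
move=> BO PQ M1P M1Q.
suff: O P <-> O Q by case.
move: O BO; apply: smallest_sub; last first.
  move=> O oO; split; apply: weak_open_same_meas => //.
  exact: same_meas_sym.
split=> //.
- move=> A hA; split=> -[h1 h2]; split=> //; tauto.
- by move=> F hF; split=> -[n _ /hF]; exists n.
Qed.

Lemma weak_compact_directed K : weak_compact K ->
  directed_compact (@weak_open X R) K.
Proof.
move=> [KM cK] F oF [G0 FG0] dF KF.
(* Covers are indexed by a whole type, so sets outside [F] are replaced by the empty set. *)
have [] := cK (set (Meas X R)) (fun G => if pselect (F G) then G else set0).
- by move=> G; case: pselect => [FG|nFG] /=; [exact: oF|exact: weak_open_set0].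
- by move=> P /KF[G FA AP]; exists G => //; case: pselect.
move=> D [/finite_seqP[s ->] KD].
suff [G [FA sA]] : exists G, F G /\ forall V, V \in s -> F V -> V `<=` G.
  exists G; split=> // P /KD[V /= Bs]; case: pselect => // FB; exact: sA.
elim: s {KD} => [|V s [G [FA sA]]]; first by exists G0.
have [FB|nFB] := pselect (F V).
  have [C [FC ABC]] := dF _ _ FA FB; exists C; split=> // V'.
  rewrite inE => /orP[/eqP -> _ P BP|V's FV' P V'P]; apply: ABC.
    by right.
  by left; exact: sA V'P.
exists G; split=> // V'; rewrite inE => /orP[/eqP -> //|]; exact: sA.
Qed.

Lemma weak_compactD (K O : set (Meas X R)) : weak_compact K -> weak_open O -> weak_compact (K `\` O).
Proof.
move=> [KM cK] oO; split; first by move=> P [/KM].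
move=> I V oV KV.
have [] := cK (option I) (fun i => if i is Some j then V j else O).
- by case.
- move=> P KP; have [OP|nOP] := pselect (O P); first by exists None.
  by have [i _ ?] := KV P (conj KP nOP); exists (Some i).
move=> D [fD KD]; exists (Some @^-1` D); split.
  by apply: finite_preimage => // i j _ _ [].
by move=> P [/KD[[i|//] Di ViP] nOP]; exists i.
Qed.

End WeakTopology.

(** * Weakly compact sets are uniformly absolutely continuous *)

Lemma ler_fsum (R : realType) (T : choiceType) (D : set T) (f g : T -> R) :
  finite_set D -> (forall i, D i -> f i <= g i) ->
  \sum_(i \in D) f i <= \sum_(i \in D) g i.
Proof.
move=> fD fg; rewrite -lee_fin -!fsumEFin //.
by apply: lee_fsum => // i Di; rewrite lee_fin; exact: fg.
Qed.

Section Radon.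
Context {X : ptopologicalType} {R : realType}.
Hypothesis hX : hausdorff_space X.
Implicit Types (P Q : Meas X R) (A B : set (mX X)).

Lemma compact_measurable (K : set X) : compact K -> measurable (K : set (mX X)).
Proof.
move=> cK; rewrite -[K]setCK; apply: measurableC; apply: sub_sigma_algebra.
by rewrite openC; exact: compact_closed.
Qed.

Lemma M1P P : M1 P <-> forall B (e : R), measurable B -> 0 < e ->
  exists K : set X, [/\ compact K, K `<=` B & fine (P B) - e < fine (P (K : set (mX X)))].
Proof.
split=> [rP B e mB e0|h B mB].
  have := rP B mB; rewrite (measE P mB) => EB.
  have : ((fine (P B) - e)%:E < ereal_sup
      [set P (K : set (mX X)) | K in [set K : set X | compact K /\ K `<=` B]])%E.
    by rewrite -EB lte_fin; lra.
  move=> /ereal_sup_gt[_ [K [cK KB] <-]].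
  by rewrite (measE P (compact_measurable cK)) lte_fin => hK; exists K.
apply/eqP; rewrite eq_le; apply/andP; split; last first.
  apply: ge_ereal_sup => _ [K [cK KB] <-].
  by apply: le_measure; rewrite ?inE //; exact: compact_measurable.
apply/lee_addgt0Pr => e e0; have [K [cK KB hK]] := h B e mB e0.
apply: (@le_trans _ _ (P (K : set (mX X)) + e%:E)%E).
  by rewrite (measE P mB) (measE P (compact_measurable cK)) -EFinD lee_fin; lra.
by rewrite leeD2r // ereal_sup_ubound //; exists K.
Qed.

Lemma common_compact (P : nat -> Meas X R) n B (e : R) :
  (forall k, M1 (P k)) -> measurable B -> 0 < e ->
  exists K : set X, [/\ compact K, K `<=` B & forall k, (k < n)%N ->
    fine (P k B) - e < fine (P k (K : set (mX X)))].
Proof.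
move=> rP mB e0; elim: n => [|n [K [cK KB hK]]].
  by exists set0; split=> //; exact: compact0.
have /M1P/(_ B e mB e0)[K' [cK' KB' hK']] := rP n.
have cKK : compact (K `|` K') by exact: compactU.
exists (K `|` K'); split=> //; first by rewrite subUset.
move=> k; rewrite ltnS leq_eqVlt => /orP[/eqP ->|kn].
  apply: (lt_le_trans hK'); apply: le_fine_meas; [exact: compact_measurable..|].
  exact: subsetUr.
apply: (lt_le_trans (hK k kn)); apply: le_fine_meas; [exact: compact_measurable..|].
exact: subsetUl.
Qed.

Lemma half_pow_lt (e : R) : 0 < e -> exists n, 2 ^- n < e.
Proof.
move=> e0; have /cvgrPdist_lt/(_ _ e0)[n _ /(_ n (leqnn _))] :
    (fun n => geometric (1 : R) 2^-1 n) @ \oo --> (0 : R).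
  by apply: cvg_geometric; rewrite ger0_norm ?invr_ge0 // invf_lt1 // ltr1n.
rewrite sub0r normrN ger0_norm /geometric /= ?mul1r ?exprVn => [h|]; first by exists n.
by rewrite invr_ge0 exprn_ge0.
Qed.

Lemma sum_halves n : \sum_(k < n) 2 ^- k.+1 = 1 - 2 ^- n :> R.
Proof.
elim: n => [|n IH]; first by rewrite big_ord0 expr0 invr1 subrr.
rewrite big_ord_recr /= IH exprS invfM.
by set x := (2 ^+ n)^-1; lra.
Qed.

(** The mixture is the series of the [2^-(k+1) P_k]. Lower bounds by partial sums are enough to
    record: they dominate each component and, applied to complements, bound [Q] from above. *)
Lemma exists_mixture (P : nat -> Meas X R) : exists Q : Meas X R,
  forall n B, measurable B ->
    \sum_(k < n) 2 ^- k.+1 * fine (P k B) <= fine (Q B).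
Proof.
have w0 n : 0 <= 2 ^- n.+1 :> R by rewrite invr_ge0 exprn_ge0.
pose w n : {nonneg R} := NngNum (w0 n).
pose m : {measure set (mX X) -> \bar R} := mseries (fun n => mscale (w n) (P n)) 0.
have mE B : m B = (\sum_(k <oo) ((2 ^- k.+1)%:E * P k B))%E by [].
have mT : m setT = 1%E.
  rewrite mE (@eq_eseriesr _ _ (fun k => (1 / (2 ^ (k + 1))%:R)%:E)); last first.
    by move=> k _; rewrite probability_setT mule1 div1r natrX addn1.
  have /cvg_lim := @cvg_geometric_eseries_half R 1 0.
  by rewrite expr0 divr1; apply.
pose pB := Measure_isProbability.Build _ _ _
  (mseries (fun n => mscale (w n) (P n)) 0 : set (mX X) -> \bar R) mT.
pose Q : Meas X R := HB.pack (mseries (fun n => mscale (w n) (P n)) 0) pB.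
exists Q => n B mB; rewrite -lee_fin -measE //.
rewrite -sumEFin -(big_mkord xpredT (fun k => (2 ^- k.+1 * fine (P k B))%:E)).
rewrite [leRHS](_ : _ = m B) // mE.
under eq_bigr do rewrite EFinM -measE //.
apply: nneseries_lim_ge => k _ _; apply: mule_ge0 => //.
Qed.

Lemma mixture_component (P : nat -> Meas X R) Q n B :
  (forall n B, measurable B ->
    \sum_(k < n) 2 ^- k.+1 * fine (P k B) <= fine (Q B)) ->
  measurable B -> fine (P n B) <= 2 ^+ n.+1 * fine (Q B).
Proof.
move=> hQ mB; have := hQ n.+1 B mB; rewrite big_ord_recr /= => h.
rewrite -ler_pdivrMl ?exprn_gt0 //; apply: le_trans h.
rewrite lerDr; apply: sumr_ge0 => k _.
apply: mulr_ge0; first by rewrite invr_ge0 exprn_ge0.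
by have /andP[] := meas_bounds (P k) mB.
Qed.

Lemma M1_mixture (P : nat -> Meas X R) Q :
  (forall n B, measurable B ->
    \sum_(k < n) 2 ^- k.+1 * fine (P k B) <= fine (Q B)) ->
  (forall k, M1 (P k)) -> M1 Q.
Proof.
move=> hQ rP; apply/M1P => B e mB e0; have e2 : 0 < e / 2 by lra.
have [n hn] := half_pow_lt e2.
have [K [cK KB hK]] := common_compact n rP mB e2.
exists K; split=> //; have mK := compact_measurable cK.
have mBK : measurable (B `\` K) by exact: measurableD.
(* Passing to the complement controls the tail of the series: [Q] gives it mass at least
   [(1 - 2^-n) * (1 - e / 2)], hence [Q] of [B] minus [K] is below [e]. *)
have := hQ n _ (measurableC mBK).
rewrite fine_measC // fine_measD //.
have : \sum_(k < n) 2 ^- k.+1 * (1 - e / 2) <=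
    \sum_(k < n) 2 ^- k.+1 * fine (P k (~` (B `\` K))).
  apply: ler_sum => k _; rewrite ler_wpM2l ?invr_ge0 ?exprn_ge0 //.
  by rewrite fine_measC // fine_measD //; have := hK k (ltn_ord k); lra.
rewrite -mulr_suml sum_halves.
have := @divr_ge0 R 1 (2 ^+ n) ler01 (exprn_ge0 _ (ler0n _ _)).
rewrite div1r; move: hn; set x := 2 ^- n => hn x0 h1 h2.
have : 0 <= x * (e / 2) by rewrite mulr_ge0 //; lra.
by lra.
Qed.

Lemma exists_M1_mixture (P : nat -> Meas X R) : (forall k, M1 (P k)) ->
  exists Q : Meas X R, M1 Q /\ forall n B, measurable B ->
    fine (P n B) <= 2 ^+ n.+1 * fine (Q B).
Proof.
move=> rP; have [Q hQ] := exists_mixture P; exists Q; split.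
  exact: M1_mixture rP.
by move=> n B; exact: mixture_component.
Qed.

(* Dini: [P |-> P (F n)] decreases to [0] through weakly continuous functions. *)
Lemma weak_compact_dini (K : set (Meas X R)) (F : (set (mX X))^nat) (e : R) :
  weak_compact K -> (forall n, measurable (F n)) ->
  {homo F : n m / (n <= m)%N >-> m `<=` n} -> \bigcap_n F n = set0 -> 0 < e ->
  exists n, forall P, K P -> fine (P (F n)) < e.
Proof.
move=> cK mF decF F0 e0.
pose V n := [set P : Meas X R | M1 P /\ fine (P (F n)) < e].
have [_ [[n _ <-] KV]] : exists G, range V G /\ K `<=` G.
  apply: (weak_compact_directed cK).
  - by move=> _ [n _ <-]; exact: weak_open_lt.
  - by exists (V 0%N), 0%N.
  - move=> _ _ [n _ <-] [m _ <-]; exists (V (maxn n m)); split; first by exists (maxn n m).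
    move=> P [|] [M1P hP]; split=> //; apply: le_lt_trans hP; apply: le_fine_meas => //.
      by apply: decF; exact: leq_maxl.
    by apply: decF; exact: leq_maxr.
  - move=> P KP; have cv : P \o F @ \oo --> P (\bigcap_n F n).
      apply: nonincreasing_cvg_mu => //.
      + by rewrite ltey_eq fin_num_measure.
      + by rewrite F0.
      + by move=> n m nm; apply/subsetPset; exact: decF.
    move: cv; rewrite F0 measure0 => /fine_cvgP[_ /cvgrPdist_lt/(_ _ e0)[n _]].
    move=> /(_ n (leqnn _)); rewrite sub0r normrN /= => h.
    exists (V n); first by exists n.
    split; first by case: cK => + _; exact.
    by apply: le_lt_trans h; exact: ler_norm.
by exists n => P /KV[].
Qed.

(* Otherwise choose [P_n] in [K] and [A_n] with [P_n A_n >= e] and [P_i A_n <= 2^-n]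
   for [i < n], by mixing the measures already chosen into the reference measure;
   the tails of [A_n], with the limit superior removed, contradict Dini. *)
Lemma weak_compact_uniform_ac (K : set (Meas X R)) (Q0 : Meas X R) (e : R) :
  weak_compact K -> M1 Q0 -> 0 < e ->
  exists (Q : Meas X R) (d : R), [/\ M1 Q, 0 < d & forall P B, K P -> measurable B ->
    fine (Q B) < d -> fine (P B) < e].
Proof.
move=> cK M1Q0 e0; apply: contrapT => no.
have KM : K `<=` @M1 X R by case: cK.
(* The threshold [8^-n] absorbs the factor at most [4^n] lost through the nested mixtures and still
   leaves a summable [2^-n]. The pair with [set0] is a default that makes the choice function
   total. *)
have step (Qn : Meas X R * nat) : exists PA : Meas X R * set (mX X), M1 Qn.1 ->
    [/\ K PA.1, measurable PA.2, fine (Qn.1 PA.2) < 8 ^- Qn.2 & e <= fine (PA.1 PA.2)].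
  have [M1Q|] := pselect (M1 Qn.1); last by exists (Q0, set0).
  apply: contrapT => no'; apply: no; exists Qn.1, (8 ^- Qn.2); split=> //.
  move=> P B KP mB QB; rewrite ltNge; apply/negP => eP; apply: no'.
  by exists (P, B).
have [g hg] := choice step.
have mix (PQ : Meas X R * Meas X R) : exists Q : Meas X R, M1 PQ.1 -> M1 PQ.2 ->
    M1 Q /\ forall B, measurable B -> fine (PQ.1 B) <= 2 * fine (Q B) /\
                                      fine (PQ.2 B) <= 4 * fine (Q B).
  have [[M1P M1Q]|nM] := pselect (M1 PQ.1 /\ M1 PQ.2); last first.
    by exists Q0 => h1 h2; case: nM.
  have [] := @exists_M1_mixture (fun n => if n is 0%N then PQ.1 else PQ.2).
    by case.
  move=> Q [M1Q' hQ]; exists Q => _ _; split=> // B mB.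
  have := hQ 0%N B mB; have := hQ 1%N B mB.
  by rewrite expr1 (_ : 2 ^+ 2 = 4 :> R) //; rewrite expr2; lra.
have [f hf] := choice mix.
pose Qs := fix Qs n := if n is k.+1 then f ((g (Qs k, k)).1, Qs k) else Q0.
pose Ps n := (g (Qs n, n)).1; pose As n := (g (Qs n, n)).2.
have M1Qs n : M1 (Qs n).
  elim: n => [//|n IH] /=; have [KP _ _ _] := hg (Qs n, n) IH.
  by case: (hf ((g (Qs n, n)).1, Qs n) (KM _ KP) IH).
have KPs n : K (Ps n) by case: (hg (Qs n, n) (M1Qs n)).
have mAs n : measurable (As n) by case: (hg (Qs n, n) (M1Qs n)).
have eAs n : e <= fine (Ps n (As n)) by case: (hg (Qs n, n) (M1Qs n)).
have QAs n : fine (Qs n (As n)) < 8 ^- n by case: (hg (Qs n, n) (M1Qs n)).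
have dom n B : measurable B -> fine (Ps n B) <= 2 * fine (Qs n.+1 B) /\
                               fine (Qs n B) <= 4 * fine (Qs n.+1 B).
  by move=> mB; have [_ /(_ B mB)] := hf ((g (Qs n, n)).1, Qs n) (KM _ (KPs n)) (M1Qs n).
have dom4 i j B : measurable B -> fine (Ps i B) <= 2 * 4 ^+ j * fine (Qs (i.+1 + j)%N B).
  move=> mB; elim: j => [|j IH]; first by rewrite expr0 mulr1 addn0; case: (dom i B mB).
  apply: (le_trans IH); rewrite exprSr mulrA -[leRHS]mulrA.
  apply: ler_wpM2l; first by rewrite mulr_ge0 // exprn_ge0.
  by rewrite addnS; case: (dom (i.+1 + j)%N B mB).
(* The factor [2^i] makes the bound trivial for [n <= i], so it is summable in [n] for every fixed
   [i]. *)
have PA i n : fine (Ps i (As n)) <= 2 ^+ i / 2 ^+ n.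
  have [ni|] := leqP n i.
    apply: (@le_trans _ _ 1); first by have /andP[] := meas_bounds (Ps i) (mAs n).
    by rewrite ler_pdivlMr ?exprn_gt0 // mul1r ler_eXn2l // ltr1n.
  move=> iN; apply: (@le_trans _ _ (2 ^- n)); last first.
    by rewrite ler_peMl ?invr_ge0 ?exprn_ge0 // exprn_ege1 // ler1n.
  have := dom4 i (n - i.+1)%N (As n) (mAs n); rewrite subnKC // => h.
  apply: (le_trans h); apply: (@le_trans _ _ (4 ^+ n * 8 ^- n)).
    apply: ler_pM.
    - by apply: mulr_ge0 => //; apply: exprn_ge0.
    - by have /andP[] := meas_bounds (Qs n) (mAs n).
    - apply: (@le_trans _ _ (4 * 4 ^+ (n - i.+1))).
        by rewrite ler_wpM2r ?exprn_ge0 // ler_nat.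
      by rewrite -exprS ler_weXn2l ?ler1n // -subSn // subSS leq_subr.
    - exact: ltW.
  by rewrite -exprVn -exprMn -exprVn (_ : 4 / 8 = 2^-1 :> R) //; lra.
pose L := lim_sup_set As.
have mtail m : measurable (\bigcup_(k in [set k | (m <= k)%N]) As k) by exact: bigcup_measurable.
have mL : measurable L by exact: bigcap_measurable.
(* Borel-Cantelli: the limit superior is null for every chosen [P_i] simultaneously. *)
have PL i : fine (Ps i L) = 0.
  rewrite /L (@lim_sup_set_cvg0 _ _ _ (Ps i)) //.
  apply: (@le_lt_trans _ _ (\sum_(k <oo) (2 ^+ i.+1 / (2 ^ (k + 1))%:R)%:E)%E).
    apply: lee_nneseries => // k _.
    apply: (@le_trans _ _ (fine (Ps i (As k)))%:E).
      by rewrite -(measE (Ps i) (mAs k)).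
    rewrite lee_fin; apply: (le_trans (PA i k)).
    by rewrite natrX addn1 !exprS invfM mulrACA divff // mul1r.
  have /cvg_lim := @cvg_geometric_eseries_half R (2 ^+ i.+1) 0.
  by rewrite expr0 divr1 => -> //; rewrite ltey.
have [] := @weak_compact_dini K
  (fun m => (\bigcup_(k in [set k | (m <= k)%N]) As k) `\` L) e cK _ _ _ e0.
- by move=> m; exact: measurableD.
- move=> n m nm; apply: setSD => x [k /= mk Ax]; exists k => //=.
  exact: leq_trans mk.
- rewrite -subset0 => x hx; have [_ nL] := hx 0%N I; apply: nL => m _.
  by case: (hx m I).
move=> m /(_ (Ps m) (KPs m)); apply/negP; rewrite -leNgt.
apply: (le_trans (eAs m)).
rewrite (@le_trans _ _ (fine (Ps m (\bigcup_(k in [set k | (m <= k)%N]) As k)))) //.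
  by apply: le_fine_meas => // x Ax; exists m => /=.
rewrite fine_measD //; first by rewrite PL subr0.
by move=> x; apply.
Qed.

Lemma fine_meas_bigcup P (a : set (set X)) : finite_set a ->
  (forall A, a A -> measurable (A : set (mX X))) ->
  (forall A B, a A -> a B -> A <> B -> A `&` B = set0) ->
  fine (P (\bigcup_(A in a) A : set (mX X))) = \sum_(A \in a) fine (P (A : set (mX X))).
Proof.
move=> fa ma ta; rewrite (measure_fin_bigcup P fa) //; last first.
  by apply/trivIsetP => A B aA aB /eqP AB; exact: ta.
rewrite (eq_fsbigr (fun A => (fine (P (A : set (mX X))))%:E)); last first.
  by move=> A; rewrite inE => aA; rewrite -measE //; exact: ma.
by rewrite fsumEFin.
Qed.

(** A Markov bound, uniform over partitions: on the union [AS] of the cells where [P] exceeds [L Q]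
    one has [L Q(AS) <= P(AS) <= 1], so [Q(AS) < d] however fine [a] is. *)
Lemma l1_excess_lt (a : set (set X)) P Q (d e L : R) : finite_borel_partition a ->
  (forall B, measurable B -> fine (Q B) < d -> fine (P B) < e) -> 0 < d -> 1 / d < L ->
  l1_excess a L (projM a P) (projM a Q) < e.
Proof.
move=> [fa ma ta _] ac d0 dL.
have L0 : 0 < L by apply: lt_trans dL; rewrite divr_gt0.
pose S := [set A | a A /\ L * fine (Q A) < fine (P A)].
have Sa : S `<=` a by move=> A [].
have fS : finite_set S by exact: sub_finite_set fa.
have mS A : S A -> measurable (A : set (mX X)) by move=> /Sa/ma[].
have tS A B : S A -> S B -> A <> B -> A `&` B = set0 by move=> /Sa + /Sa; exact: ta.
pose AS : set (mX X) := \bigcup_(A in S) A.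
have mAS : measurable AS by exact: fin_bigcup_measurable.
have PS : l1_excess a L (projM a P) (projM a Q) <= fine (P AS).
  rewrite /l1_excess /AS (fine_meas_bigcup P fS mS tS).
  rewrite -(fsbig_widen S) //; last first.
    move=> A [aA nSA] /=; rewrite /projM mem_set // min_l ?subrr ?normr0 //.
    by rewrite leNgt; apply/negP => h; apply: nSA.
  apply: ler_fsum => // A [aA h]; rewrite /projM mem_set // min_r; last exact: ltW.
  have /andP[Q0 _] := meas_bounds Q (proj2 (ma _ aA)).
  have LQ : 0 <= L * fine (Q A) by apply: mulr_ge0 => //; exact: ltW.
  by rewrite ger0_norm; lra.
apply: (le_lt_trans PS); apply: ac => //.
suff : L * fine (Q AS) <= 1.
  rewrite -ler_pdivlMl // mulr1 => h; apply: (le_lt_trans h).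
  by rewrite invf_plt // -div1r.
apply: (@le_trans _ _ (fine (P AS))); last by have /andP[] := meas_bounds P mAS.
rewrite /AS (fine_meas_bigcup P fS mS tS) (fine_meas_bigcup Q fS mS tS).
by rewrite mulr_fsumr; apply: ler_fsum => // A [_ /ltW].
Qed.

End Radon.

(** * Simplices and cylinder sets *)

Lemma ler_norm_fsum (R : realType) (T : choiceType) (D : set T) (f : T -> R) :
  finite_set D -> `|\sum_(i \in D) f i| <= \sum_(i \in D) `|f i|.
Proof. by move=> fD; rewrite !fsbig_finite //; exact: ler_norm_sum. Qed.

Lemma fsumrB (R : realType) (T : choiceType) (D : set T) (f g : T -> R) :
  finite_set D ->
  \sum_(i \in D) f i - \sum_(i \in D) g i = \sum_(i \in D) (f i - g i).
Proof. by move=> fD; rewrite !fsbig_finite // sumrB. Qed.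

Section Simplex.
Context {X : ptopologicalType} {R : realType}.
Implicit Types (p q : set X -> R) (a b : set (set X)) (P Q : Meas X R).

(** Summing cells is a contraction for this distance, with no factor depending on their number,
    unlike for the coordinatewise bounds of [simplex_open]. *)
Definition l1_dist a p q : R := \sum_(A \in a) `|q A - p A|.

Lemma l1_dist_ge a p q A : finite_set a -> a A -> `|q A - p A| <= l1_dist a p q.
Proof.
move=> fa aA; rewrite /l1_dist (fsbigD1 A) //= lerDl.
by apply: fsumr_ge0.
Qed.

Lemma l1_dist_triangle a p q r : finite_set a ->
  l1_dist a p r <= l1_dist a p q + l1_dist a q r.
Proof.
move=> fa; rewrite /l1_dist -fsbig_split //; apply: ler_fsum => // A _ /=.
by rewrite addrC; apply: le_trans (ler_normD _ _); rewrite subrKA.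
Qed.

Lemma simplex_openP a (O : set (set X -> R)) : finite_set a ->
  simplex_open a O <-> O `<=` simplex a /\ forall p, O p ->
    exists e : R, 0 < e /\ forall q, simplex a q -> l1_dist a p q < e -> O q.
Proof.
move=> fa; split=> -[Os oO]; split=> // p /oO [e [e0 sub]].
  exists e; split=> // q sq pq; apply: sub; split=> // A aA.
  by apply: le_lt_trans pq; exact: l1_dist_ge.
pose N : R := \sum_(A \in a) (1 : R).
have N0 : 0 <= N by apply: fsumr_ge0.
exists (e / (N + 1)); split; first by rewrite divr_gt0 //; lra.
move=> q [sq pq]; apply: sub => //.
apply: (@le_lt_trans _ _ (e / (N + 1) * N)); last first.
  by rewrite -mulrA gtr_pMr // mulrC ltr_pdivrMr ?mul1r; lra.
rewrite /N mulr_fsumr; apply: ler_fsum => // A aA.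
by rewrite mulr1; apply/ltW/pq.
Qed.

Lemma simplex_open_sub a (O : set (set X -> R)) : simplex_open a O -> O `<=` simplex a.
Proof. by case. Qed.

Lemma simplex_open0 a : simplex_open a (set0 : set (set X -> R)).
Proof. by split. Qed.

Lemma simplex_open_full a : simplex_open a (@simplex X R a).
Proof. by split=> // p _; exists 1; split=> // q []. Qed.

Lemma simplex_openI a (O1 O2 : set (set X -> R)) :
  simplex_open a O1 -> simplex_open a O2 -> simplex_open a (O1 `&` O2).
Proof.
move=> [s1 o1] [s2 o2]; split; first by move=> p [/s1].
move=> p [/o1[e1 [e10 h1]] /o2[e2 [e20 h2]]].
exists (Num.min e1 e2); split; first by rewrite lt_min e10.
by move=> q [sq hq]; split; [apply: h1|apply: h2]; split=> // A /hq;
  rewrite lt_min => /andP[].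
Qed.

Lemma simplex_openU a (O1 O2 : set (set X -> R)) :
  simplex_open a O1 -> simplex_open a O2 -> simplex_open a (O1 `|` O2).
Proof.
move=> [s1 o1] [s2 o2]; split; first by move=> p [/s1|/s2].
move=> p [/o1[e [e0 h]]|/o2[e [e0 h]]]; exists e; split=> //.
  by apply: (subset_trans h) => q; left.
by apply: (subset_trans h) => q; right.
Qed.

Lemma simplex_borel_sigma a : sigma_algebra (@simplex X R a) (simplex_borel a).
Proof. exact: smallest_sigma_algebra. Qed.

Lemma simplex_borel_sub a (B : set (set X -> R)) : simplex_borel a B -> B `<=` simplex a.
Proof.
move: B; apply: smallest_sub; last by move=> O [].
by split=> [p []|A _ p []|F hF p [n _ /hF]].
Qed.

Lemma simplex_open_borel a (O : set (set X -> R)) : simplex_open a O -> simplex_borel a O.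
Proof. exact: sub_sigma_algebra. Qed.

(** The points of the simplex at distance at least [1 / (n+1)] from the complement of [W]: closed
    sets exhausting the open set [W]. *)
Definition simplex_inner a (W : set (set X -> R)) (n : nat) : set (set X -> R) :=
  [set p | simplex a p /\ forall q, simplex a q -> l1_dist a p q < n.+1%:R^-1 -> W q].

Lemma simplex_inner_bigcup a (W : set (set X -> R)) : finite_set a -> simplex_open a W ->
  \bigcup_n simplex_inner a W n = W.
Proof.
move=> fa /(simplex_openP _ fa)[Ws oW]; apply/seteqP; split=> p.
  move=> [n _ [sp]]; apply=> //.
  rewrite /l1_dist (eq_fsbigr (fun=> 0)) ?fsbig1 ?invr_gt0 ?ltr0Sn //.
  by move=> A _; rewrite subrr normr0.
move=> Wp; have [e [e0 he]] := oW p Wp.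
have [n hn] : exists n : nat, n.+1%:R^-1 < e.
  exists (Num.truncn e^-1); rewrite invf_plt ?posrE ?ltr0Sn //.
  exact: truncnS_gt.
exists n => //; split; first exact: Ws.
by move=> q sq pq; apply: he => //; exact: lt_trans hn.
Qed.

Lemma simplex_inner_homo a (W : set (set X -> R)) :
  {homo simplex_inner a W : n m / (n <= m)%N >-> n `<=` m}.
Proof.
move=> n m nm p [sp h]; split=> // q sq pq; apply: h => //.
apply: (lt_le_trans pq).
by rewrite lef_pV2 ?posrE ?ltr0Sn // ler_nat.
Qed.

Lemma simplex_inner_open a (W : set (set X -> R)) n : finite_set a ->
  simplex_open a (simplex a `\` simplex_inner a W n).
Proof.
move=> fa; apply/simplex_openP => //; split; first by move=> p [].
move=> p [sp np].
have [q [sq pq nWq]] : exists q, [/\ simplex a q, l1_dist a p q < n.+1%:R^-1 & ~ W q].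
  apply: contrapT => no; apply: np; split=> // q sq pq.
  by apply: contrapT => nWq; apply: no; exists q.
exists (n.+1%:R^-1 - l1_dist a p q); split; first by rewrite subr_gt0.
move=> r sr pr; split=> // -[_ /(_ q sq) rW]; apply: nWq; apply: rW.
apply: (le_lt_trans (@l1_dist_triangle a r p q fa)).
have -> : l1_dist a r p = l1_dist a p r by apply: eq_fsbigr => A _; rewrite distrC.
by move: pr; rewrite ltrBrDr.
Qed.

Definition cyl a (W : set (set X -> R)) : set (Meas X R) :=
  [set P | M1 P /\ W (projM a P)].

Lemma projM_simplex a P : finite_borel_partition a -> simplex a (projM a P).
Proof.
move=> [fa ma ta ca]; split.
- by move=> A naA; rewrite /projM memNset.
- move=> A aA; rewrite /projM mem_set //.
  by have /andP[] := meas_bounds P (proj2 (ma _ aA)).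
- rewrite (eq_fsbigr (fun A : set X => fine (P (A : set (mX X))))); last first.
    by move=> A aA; rewrite /projM aA.
  rewrite -fine_meas_bigcup //; last by move=> A /ma[].
  by rewrite ca fine_measT.
Qed.

Lemma cyl_weak_open a W : finite_borel_partition a -> simplex_open a W ->
  weak_open (cyl a W).
Proof.
move=> pa [Ws oW]; have [fa ma _ _] := pa; apply/weak_openP; split; first by move=> P [].
move=> P [M1P WP]; have [e [e0 sub]] := oW _ WP.
have /finite_seqP[s sE] := fa; exists (s : seq (set (mX X))), e; split=> //.
  by move=> B Bs; have [] : B !=set0 /\ measurable B by apply: ma; rewrite sE.
move=> Q [M1Q hQ]; split=> //; apply: sub; split.
  exact: projM_simplex.
by move=> A aA; rewrite /projM mem_set //; apply: hQ; rewrite sE in aA.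
Qed.

Lemma l1_excess_open a (d L : R) q : finite_set a ->
  simplex_open a [set p | simplex a p /\ d < l1_excess a L p q].
Proof.
move=> fa; apply/simplex_openP => //; split; first by move=> p [].
move=> p [sp hp]; exists (l1_excess a L p q - d); split; first by rewrite subr_gt0.
move=> r sr pr; split=> //.
suff : l1_excess a L p q <= l1_excess a L r q + l1_dist a p r by lra.
rewrite /l1_excess /l1_dist -fsbig_split //; apply: ler_fsum => // A _ /=.
(* Each summand of the excess is the positive part of [x - c], hence 1-Lipschitz in [x]. *)
have h (x c : R) : `|x - Num.min x c| = Num.max (x - c) 0.
  case: (leP x c) => xc; first by rewrite subrr normr0 max_r // subr_le0.
  by rewrite max_l ?ger0_norm // subr_ge0 ltW.
rewrite !h ge_max; apply/andP; split; last by rewrite addr_ge0 // le_max lexx orbT.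
have : r A - L * q A <= Num.max (r A - L * q A) 0 by rewrite le_max lexx.
have := ler_norm (- (r A - p A)); rewrite normrN.
by lra.
Qed.

(** * Passing from a partition to a coarser one *)

Section Transition.
Context {a b : set (set X)}.
Hypotheses (pa : finite_borel_partition a) (pb : finite_borel_partition b).
Hypothesis ab : refines a b.

Let fa : finite_set a. Proof. by case: pa. Qed.
Let fb : finite_set b. Proof. by case: pb. Qed.

(** Each cell of [b] lies in exactly one cell of [a]: existence is refinement, uniqueness comes from
    disjointness of the cells of [a] and nonemptiness of those of [b]. *)
Lemma fsum_transition (f : set X -> R) :
  \sum_(A \in a) \sum_(B \in [set B | b B /\ B `<=` A]) f B = \sum_(B \in b) f B.
Proof.
transitivity (\sum_(A \in a) \sum_(B \in b) if `[< B `<=` A >] then f B else 0).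
  apply: eq_fsbigr => A _.
  rewrite -(fsbig_widen [set B | b B /\ B `<=` A] b); last first.
  - by move=> B [bB nS] /=; case: asboolP => // BA; case: nS.
  - by move=> B [].
  by apply: eq_fsbigr => B; rewrite inE => -[_ BA]; case: asboolP.
rewrite exchange_fsbig //; apply: eq_fsbigr => B; rewrite inE => bB.
have [A [aA BA]] := ab bB.
rewrite -(fsbig_widen [set A] a); last first.
- move=> A' [aA' nA'] /=; case: asboolP => // BA'; exfalso.
  case: pb => _ /(_ B bB)[[x Bx] _] _ _; case: pa => _ _ ta _.
  have : (A `&` A') x by split; [exact: BA|exact: BA'].
  by rewrite ta // => AA'; apply: nA'; rewrite AA'.
- by move=> _ ->.
by rewrite fsbig_set1; case: asboolP.
Qed.

Lemma transition_simplex p : simplex b p -> simplex a (transition a b p).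
Proof.
move=> [p0 pge0 p1]; split.
- by move=> A naA; rewrite /transition memNset.
- by move=> A aA; rewrite /transition mem_set //; apply: fsumr_ge0 => B [/pge0].
- rewrite -p1 -fsum_transition; apply: eq_fsbigr => A aA.
  by rewrite /transition aA.
Qed.

Lemma transition_l1_dist p q :
  l1_dist a (transition a b p) (transition a b q) <= l1_dist b p q.
Proof.
rewrite {2}/l1_dist -fsum_transition; apply: ler_fsum => // A aA.
have fS : finite_set [set B | b B /\ B `<=` A] by apply: sub_finite_set fb => B [].
by rewrite /transition mem_set // fsumrB //; exact: ler_norm_fsum.
Qed.

Definition transition_preimage (W : set (set X -> R)) : set (set X -> R) :=
  [set p | simplex b p /\ W (transition a b p)].

Lemma transition_preimage_open W : simplex_open a W ->
  simplex_open b (transition_preimage W).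
Proof.
move=> /(simplex_openP _ fa)[Ws oW]; apply/simplex_openP => //.
split; first by move=> p [].
move=> p [sp /oW[e [e0 h]]]; exists e; split=> // q sq pq; split=> //.
apply: h; first exact: transition_simplex.
exact: le_lt_trans (transition_l1_dist _ _) pq.
Qed.

Lemma transition_projM P : transition a b (projM b P) = projM a P.
Proof.
case: pa => _ ma ta ca; case: pb => _ mb tb cb.
apply/funext => A; rewrite /transition /projM; case: ifPn => // /set_mem aA.
rewrite (eq_fsbigr (fun B : set X => fine (P (B : set (mX X))))); last first.
  by move=> B; rewrite inE => -[bB _]; rewrite mem_set.
rewrite -fine_meas_bigcup //; first last.
- by move=> B B' [bB _] [bB' _]; exact: tb.
- by move=> B [/mb[]].
- by apply: sub_finite_set fb => B [].
congr (fine (P _)); apply/seteqP; split=> x; first by move=> [B [_ BA] /BA].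
move=> Ax; have : (\bigcup_(B in b) B) x by rewrite cb.
move=> [B bB Bx]; exists B => //; split=> //.
have [A' [aA' BA']] := ab bB.
have [->//|AA'] := pselect (A = A').
have : (A `&` A') x by split=> //; exact: BA'.
by rewrite ta.
Qed.

Lemma cyl_transition W : cyl a W = cyl b (transition_preimage W).
Proof.
apply/seteqP; split=> P [M1P h]; split=> //.
  by split; [exact: projM_simplex|rewrite transition_projM].
by case: h => _; rewrite transition_projM.
Qed.

End Transition.

End Simplex.

(** * Compactness of sets of dominated measures *)

Section DominatedMeasures.
Context {X : ptopologicalType} {R : realType}.
Hypothesis hX : hausdorff_space X.
Implicit Types (P : Meas X R) (A B : set (mX X)).
Variables (Q : Meas X R) (L : nat -> R).
Hypotheses (M1Q : M1 Q) (L_gt0 : forall n, 0 < L n).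

Definition dominated : set (Meas X R) :=
  [set P | M1 P /\ forall n B, measurable B ->
    fine (P B) <= L n * fine (Q B) + 2 ^- n].

(* Coordinates at non-measurable sets are irrelevant; they are kept in [0, 1] so that
   the whole space of such functions sits in a product of compact intervals. *)
Definition dominated_content (f : set (mX X) -> R) : Prop :=
  [/\ forall B, 0 <= f B <= 1, f setT = 1,
      forall A B, measurable A -> measurable B -> A `&` B = set0 ->
        f (A `|` B) = f A + f B
    & forall n B, measurable B -> f B <= L n * fine (Q B) + 2 ^- n].

(** The bounds for all [n] together form an epsilon-delta modulus: [n] is fixed first, to make
    [2^-n] less than half of [e], and only then the threshold, in terms of [L n]. *)
Let bound_small (e : R) : 0 < e -> exists n d, 0 < d /\
  forall x, x < d -> L n * x + 2 ^- n < e.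
Proof.
move=> e0; have e2 : 0 < e / 2 by lra.
have [n hn] := half_pow_lt e2; exists n, (e / 2 / L n); split.
  by rewrite divr_gt0.
move=> x; rewrite ltr_pdivlMr // mulrC => hx.
by rewrite [e]splitr ltrD.
Qed.

(** Countable additivity is continuity at the empty set, which the modulus transfers from [Q]; the
    same modulus transfers approximation by compact sets, hence Radonness. *)
Lemma dominated_content_measure f : dominated_content f ->
  exists P : Meas X R, dominated P /\ forall B, measurable B -> fine (P B) = f B.
Proof.
move=> [f01 fT fU fQ].
have f0 : f set0 = 0.
  have := fU set0 set0 measurable0 measurable0 (set0I _); rewrite setU0; lra.
pose m (B : set (mX X)) := (f B)%:E.
have m0 : m set0 = 0%E by rewrite /m f0.
have m_ge0 B : (0 <= m B)%E by rewrite lee_fin; case/andP: (f01 B).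
have fD A B : measurable A -> measurable B -> B `<=` A -> f (A `\` B) = f A - f B.
  move=> mA mB BA; have := fU B (A `\` B) mB (measurableD mA mB) (setDIK _ _).
  by rewrite setDUK // => ->; lra.
have m_sigma : semi_sigma_additive m.
  move=> F mF tF mU; set U := \bigcup_n F n.
  pose V n := \big[setU/set0]_(i < n) F i.
  have mV n : measurable (V n) by exact: bigsetU_measurable.
  have VE n : (\sum_(0 <= i < n) m (F i))%E = (f (V n))%:E.
    rewrite /V; elim: n => [|n IH]; first by rewrite big_nil big_ord0 f0.
    rewrite big_nat_recr //= IH big_ord_recr /= -EFinD -fU //; first exact: mV.
    rewrite -bigcup_mkord -subset0 => x [[k /= kn Fkx] Fnx].
    have kn' : k = n by apply: (tF k n I I); exists x.
    by rewrite kn' ltnn in kn.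
  have VU n : V n `<=` U by rewrite /V -bigcup_mkord; exact: bigcup_subset.
  rewrite (_ : (fun n => _) = (fun n => (f (V n))%:E)); last by apply/funext.
  apply/fine_cvgP; split; first by near=> n.
  apply/cvgrPdist_lt => e e0; have [k [d [d0 hd]]] := bound_small e0.
  have : Q \o (fun n => U `\` V n) @ \oo --> Q (\bigcap_n (U `\` V n)).
    apply: nonincreasing_cvg_mu => //.
    - by rewrite ltey_eq fin_num_measure //; exact: measurableD.
    - by move=> n; exact: measurableD.
    - by apply: bigcap_measurable => // n _; exact: measurableD.
    - move=> n p np; apply/subsetPset; apply: setDS; rewrite /V -!bigcup_mkord.
      by apply: bigcup_subset => i /= /leq_trans; exact.
  rewrite (_ : \bigcap_n (U `\` V n) = set0); last first.
    rewrite -subset0 => x hx; have [[n _ Fnx] _] := hx 0%N I.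
    have [_ ] := hx n.+1 I; apply; rewrite /V -bigcup_mkord; exists n => //=.
  rewrite measure0 => /fine_cvgP[_ /cvgrPdist_lt/(_ _ d0) hQ].
  near=> n; rewrite /= -fD // ger0_norm; last by case/andP: (f01 (U `\` V n)).
  apply: (le_lt_trans (fQ k _ (measurableD mU (mV n)))); apply: hd.
  have : `|0 - fine (Q (U `\` V n))| < d by near: n.
  by rewrite sub0r normrN; apply: le_lt_trans; exact: ler_norm.
have mT : m setT = 1%E by rewrite /m fT.
pose mB := isMeasure.Build _ _ _ m m0 m_ge0 m_sigma.
pose mu : {measure set (mX X) -> \bar R} := HB.pack m mB.
(* Normalizing a measure of mass one changes nothing but packages it as a probability; [Q] is only
   the default for degenerate mass. *)
pose P : Meas X R := mnormalize mu Q.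
have PE B : P B = (f B)%:E.
  rewrite /P /= /mnormalize /= mT.
  by rewrite onee_eq0 /= /m fT invr1 mule1.
exists P; split=> [|B mB']; last by rewrite PE.
split=> [|n B mB']; last by rewrite PE; exact: fQ.
apply/(M1P hX) => B e mB' e0; have [k [d [d0 hd]]] := bound_small e0.
have [K [cK KB hK]] := (proj1 (M1P hX Q)) M1Q B d mB' d0.
have mK := compact_measurable hX cK.
exists K; split=> //; rewrite !PE /=.
have mBK := measurableD mB' mK.
have : f (B `\` K) < e.
  apply: (le_lt_trans (fQ k _ mBK)); apply: hd.
  by rewrite fine_measD //; lra.
by rewrite fD //; lra.
Unshelve. all: by end_near. Qed.

Import ArrowAsProduct.

Lemma nbhs_coordinates (f : set (mX X) -> R) (s : seq (set (mX X))) (d : R) : 0 < d ->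
  nbhs f [set g : set (mX X) -> R | forall B, B \in s -> `|g B - f B| < d].
Proof.
move=> d0; elim: s => [|B s IH]; first by apply: filterS filterT.
have hB : nbhs f [set g : set (mX X) -> R | `|g B - f B| < d].
  have := @proj_continuous _ (fun _ => R) B f.
  move=> /cvgrPdist_lt/(_ d d0); apply: filterS => g /=.
  by rewrite distrC.
apply: filterS (filterI IH hB) => g [h1 h2] C.
by rewrite inE => /orP[/eqP ->//|]; exact: h1.
Qed.

(** A closed subset of a cube that is compact by Tychonoff: each instance of a defining clause
    involves at most three coordinates, so a cluster point inherits it from contents close to it at
    those coordinates. *)
Lemma dominated_content_compact :
  compact [set f : set (mX X) -> R | dominated_content f].
Proof.
have cbox : compact [set f : set (mX X) -> R | forall B, `[0, 1]%classic (f B)].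
  by apply: (@tychonoff _ (fun _ => R) (fun _ => `[0, 1]%classic)) => B; exact: segment_compact.
apply: (subclosed_compact _ cbox); last first.
  by move=> f [f01 _ _ _] B /=; rewrite in_itv /=; exact: f01.
move=> f clf.
have approx (s : seq (set (mX X))) (e : R) : 0 < e -> exists g, dominated_content g /\
    forall B, B \in s -> `|g B - f B| < e.
  by move=> e0; have [g []] := clf _ (nbhs_coordinates f s e0); exists g.
split.
- move=> B; apply/andP; split; apply/ler_addgt0Pr => e e0.
    have [g [[g01 _ _ _] /(_ B)]] := approx [:: B] e e0.
    rewrite mem_head ltr_distl => /(_ isT) /andP[h1 h2].
    by have /andP[] := g01 B; lra.
  have [g [[g01 _ _ _] /(_ B)]] := approx [:: B] e e0.
  rewrite mem_head ltr_distl => /(_ isT) /andP[h1 h2].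
  by have /andP[] := g01 B; lra.
- apply/eqP; rewrite -subr_eq0 -normr_le0; apply/ler_addgt0Pr => e e0.
  have [g [[_ gT _ _] /(_ setT)]] := approx [:: setT] e e0.
  by rewrite mem_head gT distrC => /(_ isT) /ltW; rewrite add0r.
- move=> A B mA mB AB; apply/eqP; rewrite -subr_eq0 -normr_le0.
  apply/ler_addgt0Pr => e e0; have e3 : 0 < e / 3 by lra.
  have [g [[_ _ gU _] h]] := approx [:: A; B; A `|` B] _ e3.
  have := gU A B mA mB AB.
  have := h A; have := h B; have := h (A `|` B); rewrite !inE !eqxx !orbT /=.
  move=> /(_ isT); rewrite ltr_distl => /andP[? ?].
  move=> /(_ isT); rewrite ltr_distl => /andP[? ?].
  move=> /(_ isT); rewrite ltr_distl => /andP[? ?] ?.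
  by rewrite add0r ler_norml; apply/andP; split; lra.
- move=> n B mB; apply/ler_addgt0Pr => e e0.
  have [g [[_ _ _ gQ] /(_ B)]] := approx [:: B] e e0.
  rewrite mem_head ltr_distl => /(_ isT) /andP[h1 h2].
  by have := gQ n B mB; lra.
Qed.

(* The witness is [sum_A p_A Q(. | A)]; atoms with [Q A = 0] carry no mass since [p_A] is
   then part of every excess, and the junk value [x / 0 = 0] makes their terms vanish. *)
Lemma dominated_lift (a : set (set X)) (p : set X -> R) : finite_borel_partition a ->
  simplex a p -> (forall n, l1_excess a (L n) p (projM a Q) <= 2 ^- n) ->
  exists P, dominated P /\ projM a P = p.
Proof.
move=> pa [p0 pge0 p1] pL; have [fa ma ta ca] := pa.
have mA A : a A -> measurable (A : set (mX X)) by move=> /ma[].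
have QA A : a A -> 0 <= fine (Q A) by move=> /mA /(meas_bounds Q)/andP[].
have pL1 n A : a A -> p A - Num.min (p A) (L n * fine (Q A)) <= 2 ^- n.
  move=> aA; apply: le_trans (pL n); rewrite /l1_excess (fsbigD1 A) //=.
  rewrite {1}/projM mem_set //.
  apply: (@le_trans _ _ `|p A - Num.min (p A) (L n * fine (Q A))|); first exact: ler_norm.
  by rewrite lerDl; apply: fsumr_ge0.
have p_null A : a A -> fine (Q A) = 0 -> p A = 0.
  move=> aA QA0; apply/eqP; rewrite eq_le pge0 // andbT.
  apply/ler_addgt0Pr => e e0; have [n hn] := half_pow_lt e0.
  by have := pL1 n A aA; rewrite QA0 mulr0 min_r ?pge0 //; lra.
pose w A := p A / fine (Q A).
have w0 A : a A -> 0 <= w A by move=> aA; rewrite /w divr_ge0 ?pge0 ?QA.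
have wQ A : a A -> w A * fine (Q A) = p A.
  move=> aA; rewrite /w; have [Q0|Q0] := eqVneq (fine (Q A)) 0.
    by rewrite Q0 mulr0 p_null.
  by rewrite divfK.
have mI A B : a A -> measurable B -> measurable (B `&` A).
  by move=> aA mB; apply: measurableI => //; exact: mA.
have partQ B : measurable B -> \sum_(A \in a) fine (Q (B `&` A)) = fine (Q B).
  move=> mB.

  rewrite -[in RHS](setIT B) -ca setI_bigcupr.
  rewrite (measure_fin_bigcup Q fa) //; last 2 first.
  - apply/trivIsetP => A A' aA aA' /eqP AA'.
    by rewrite setIACA setIid (ta _ _ aA aA' AA') setI0.
  - by move=> A aA; exact: mI.
  rewrite (eq_fsbigr (fun A => (fine (Q (B `&` A)))%:E)); last first.
    by move=> A; rewrite inE => aA; rewrite -measE //; exact: mI.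
  by rewrite fsumEFin.
pose f B := if `[< measurable B >] then \sum_(A \in a) w A * fine (Q (B `&` A)) else 0.
have fE B : measurable B -> f B = \sum_(A \in a) w A * fine (Q (B `&` A)).
  by rewrite /f; case: asboolP.
have le_term A B : a A -> measurable B -> w A * fine (Q (B `&` A)) <= p A.
  move=> aA mB; rewrite -wQ // ler_wpM2l ?w0 //.
  by apply: le_fine_meas; [exact: mI|exact: mA|exact: subIsetr].
have term_ge0 A B : a A -> measurable B -> 0 <= w A * fine (Q (B `&` A)).
  move=> aA mB; apply: mulr_ge0; first exact: w0.
  by have /andP[] := meas_bounds Q (mI A B aA mB).
have df : dominated_content f.
  split.
  - move=> B; rewrite /f; case: asboolP => [mB|_]; last by rewrite lexx ler01.
    apply/andP; split; first by apply: fsumr_ge0 => A aA; exact: term_ge0.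
    by rewrite -p1; apply: ler_fsum => // A aA; exact: le_term.
  - rewrite fE // -p1; apply: eq_fsbigr => A; rewrite inE => aA.
    by rewrite setTI wQ.
  - move=> A B mA' mB AB; rewrite !fE //; last exact: measurableU.
    rewrite -fsbig_split //=; apply: eq_fsbigr => C; rewrite inE => aC.
    rewrite setIUl fine_measU ?mulrDr //; [exact: mI|exact: mI|].
    by rewrite setIACA AB set0I.
  - move=> n B mB; rewrite fE //.
    apply: (le_trans _ (lerD (lexx _) (pL n))).
    rewrite -(partQ B mB) mulr_fsumr /l1_excess -fsbig_split //=.
    apply: ler_fsum => // A aA; rewrite /projM mem_set //.
    set t := fine (Q (B `&` A)).
    have t0 : 0 <= t by have /andP[] := meas_bounds Q (mI A B aA mB).
    have tQ : t <= fine (Q A).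
      by apply: le_fine_meas; [exact: mI|exact: mA|exact: subIsetr].
    (* Cellwise, [w t <= L t] plus the excess. Where the density [w] is at most [L] there is no
       excess; where it is larger, [(w - L) t <= (w - L) Q(A)], and the right side is exactly the
       excess of the cell. *)
    have [le|lt] := leP (p A) (L n * fine (Q A)).
      rewrite subrr normr0 addr0 ler_wpM2r //.
      have [Q0|Qn0] := eqVneq (fine (Q A)) 0.
        by rewrite /w Q0 invr0 mulr0 ltW.
      by rewrite /w ler_pdivrMr // lt_neqAle eq_sym Qn0 QA.
    rewrite ger0_norm; last by rewrite subr_ge0 ltW.
    have wL : L n <= w A.
      have [Q0|Qn0] := eqVneq (fine (Q A)) 0.
        by move: lt; rewrite Q0 mulr0 p_null // ltxx.
      by rewrite /w ler_pdivlMr ?ltW // lt_neqAle eq_sym Qn0 QA.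
    have := ler_wpM2l (_ : 0 <= w A - L n) tQ; rewrite subr_ge0 => /(_ wL).
    by rewrite !mulrBl wQ //; lra.
have [P [dP PE]] := dominated_content_measure df; exists P; split=> //.
apply/funext => A; rewrite /projM; case: ifPn => [/set_mem aA|/negP nA]; last first.
  by rewrite p0 // => aA; apply: nA; rewrite inE.
rewrite PE ?fE //; [|exact: mA|exact: mA].
rewrite (fsbigD1 A) //= setIid wQ // fsbig1 ?addr0 //.
by move=> B [aB /= BA]; rewrite ta // ?measure0 ?mulr0 // => AB; apply: BA.
Qed.

(** A weak neighbourhood tests finitely many Borel sets, so it corresponds to a product
    neighbourhood of contents, and a weakly open cover is moved to the compact space of contents.
    Measure and content have to agree on Borel sets only. *)
Lemma dominated_weak_compact : weak_compact dominated.
Proof.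
split; first by move=> P [].
move=> I U oU cov.
(* A triple [t] records a member of the cover, the finitely many sets it tests and the tolerance. *)
pose nb (t : I * seq (set (mX X)) * R) (f : set (mX X) -> R) := 0 < t.2 /\
  forall P, M1 P ->
    (forall B, B \in t.1.2 -> measurable B -> `|fine (P B) - f B| < t.2) -> U t.1.1 P.
have hnb f : dominated_content f -> exists t, nb t f.
  move=> df; have [P [dP PE]] := dominated_content_measure df.
  have [i _ UiP] := cov P dP.
  have /weak_openP[_ /(_ P UiP)[s [d [d0 ms sub]]]] := oU i.
  exists (i, s, d); split=> // P' M1P' hP'; apply: sub; split=> // B Bs.
  by have := hP' B Bs (ms B Bs); rewrite /= -(PE B (ms B Bs)).
pose J : choiceType := {classic ((set (mX X) -> R) * (I * seq (set (mX X)) * R))}.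
pose ball (j : J) : set (set (mX X) -> R) :=
  [set g : set (mX X) -> R | forall B, B \in j.2.1.2 -> `|g B - j.1 B| < j.2.2]°.
have /compact_near_coveringP := dominated_content_compact.
(* Near covering along finite index sets ordered by inclusion: the one index set it returns is a
   finite subcover. *)
pose sup_filter : set_system {fset J} :=
  filter_from setT (fun D : {fset J} => [set E : {fset J} | fsubset D E]).
have sup_filterP : Filter sup_filter.
  apply: filter_from_filter; first by exists fset0.
  move=> D E _ _; exists (D `|` E)%fset => // C /= DEC.
  by split; apply: fsubset_trans DEC; [exact: fsubsetUl|exact: fsubsetUr].
move=> /(_ {fset J} sup_filter (fun D g => exists j, [/\ j \in D, nb j.2 j.1 & ball j g])).
move=> /(_ sup_filterP) [].
  move=> f df; have [t tf] := hnb f df.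
  exists (ball (f, t), [set D : {fset J} | ((f, t) : J) \in D]).
    split=> /=.
      by apply: nbhs_interior; apply: nbhs_coordinates; case: tf.
    by exists [fset ((f, t) : J)]%fset => // D /= /fsubsetP; apply; rewrite inE.
  by move=> [g D] [/= gb Dj]; exists (f, t).
move=> D _ /(_ D (fsubset_refl D)) covD.
exists [set (j : J).2.1.1 | j in [set` D]]; split.
  exact/finite_image/finite_fset.
move=> P [M1P PQ].
pose g B := if `[< measurable B >] then fine (P B) else 0.
have gE B : measurable B -> g B = fine (P B) by rewrite /g; case: asboolP.
have dg : dominated_content g.
  split.
  - by move=> B; rewrite /g; case: asboolP => [/(meas_bounds P)//|_]; rewrite lexx ler01.
  - by rewrite gE // fine_measT.
  - by move=> A B mA mB AB; rewrite !gE //; [exact: fine_measU|exact: measurableU].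
  - by move=> n B mB; rewrite gE //; exact: PQ.
have [j [jD [_ /(_ P M1P) UP] /interior_subset gj]] := covD g dg.
exists j.2.1.1; first by exists j.
by apply: UP => B Bs mB; rewrite -gE //; exact: gj.
Qed.

(** The exceptional sets [Bad n] have total mass at most [e], since the [2^-(n+1)] sum to one; off
    all of them a vector is the projection of a dominated measure and so lies in [W]. *)
Lemma dominated_tight (a : set (set X)) (mu : set (set X -> R) -> \bar R) (W : set (set X -> R))
    (e : R) :
  finite_borel_partition a -> prob_on (@simplex X R a) (simplex_borel a) mu ->
  simplex_borel a W -> dominated `<=` cyl a W ->
  (forall n, (mu [set p | simplex a p /\ (2 ^- n < l1_excess a (L n) p (projM a Q))%R]
              < (e * 2 ^- n.+1)%R%:E)%E) ->
  0 < e -> 1 - e <= fine (mu W).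
Proof.
move=> pa pmu bW HW hmu e0; have [fa _ _ _] := pa.
pose Bad n : set (set X -> R) :=
  [set p | simplex a p /\ 2 ^- n < l1_excess a (L n) p (projM a Q)].
have sS := @simplex_borel_sigma X R a; have sub := @simplex_borel_sub X R a.
have bBad n : simplex_borel a (Bad n) by apply: simplex_open_borel; exact: l1_excess_open.
pose F N := \big[setU/set0]_(n < N) Bad n.
have hF N := prob_on_bigU_le pmu sS sub N bBad.
have bF N : simplex_borel a (F N) by case: (hF N).
have ndF : {homo F : n m / (n <= m)%N >-> n `<=` m}.
  by move=> n m nm; rewrite /F -!bigcup_mkord; apply: bigcup_subset => i /= /leq_trans; exact.
have bU : simplex_borel a (\bigcup_N F N) by case: sS => _ _; exact.
have Fle N : fine (mu (F N)) <= e.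
  case: (hF N) => + _ => /le_trans; apply.
  apply: (@le_trans _ _ (\sum_(n < N) e * 2 ^- n.+1)).
    by apply: ler_sum => n _; rewrite -lee_fin -(prob_on_fin pmu sS sub) //; exact/ltW/hmu.
  rewrite -mulr_sumr sum_halves ler_piMr ?ltW // lerBlDr lerDl invr_ge0 exprn_ge0 //.
have Ule : fine (mu (\bigcup_N F N)) <= e.
  apply/ler_addgt0Pr => d d0.
  have [N hN] := prob_on_approx pmu sS sub bF ndF d0.
  by have := Fle N; lra.
have := prob_on_fineC pmu sS sub bU.
have : fine (mu (simplex a `\` \bigcup_N F N)) <= fine (mu W).
  apply: (le_prob_on_fine pmu sS sub) => //; first by case: sS => _ + _; exact.
  move=> p [sp nU]; have [P [dP <-]] : exists P, dominated P /\ projM a P = p.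
    apply: dominated_lift => // n; rewrite leNgt; apply/negP => h; apply: nU.
    by exists n.+1 => //; rewrite /F -bigcup_mkord; exists n => //=.
  by have [] := HW P dP.
by lra.
Qed.

End DominatedMeasures.

(** * Separation by cylinder sets and uniqueness *)

Section Cylinders.
Context {X : ptopologicalType} {R : realType}.
Variable Al : set (set (set X)).
Hypotheses (dirAl : directed_refine Al) (resAl : resolves Al).
Hypothesis partAl : forall a, Al a -> finite_borel_partition a.
Implicit Types (P Q : Meas X R) (a b c : set (set X)).

(** Cells of different partitions need not intersect in a cell, so the pi-system consists of the
    unions of cells of a single partition: a common refinement gives stability under intersection,
    and resolution makes it generate the Borel sets. *)
Lemma partitions_separate P Q : ~ same_meas P Q ->
  exists a A, [/\ Al a, a A & fine (P (A : set (mX X))) <> fine (Q (A : set (mX X)))].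
Proof.
move=> nPQ; apply: contrapT => no; apply: nPQ.
have eqPQ a A : Al a -> a A -> fine (P (A : set (mX X))) = fine (Q (A : set (mX X))).
  by move=> Ala aA; apply: contrapT => ne; apply: no; exists a, A.
pose sat a (B : set X) := forall C, a C -> C `<=` B \/ C `&` B = set0.
pose G : set (set (mX X)) := [set B | exists a, Al a /\ sat a B].
have satE a B : Al a -> sat a B -> B = \bigcup_(C in [set C | a C /\ C `<=` B]) C.
  move=> Ala sB; have [_ _ _ ca] := partAl Ala.
  apply/seteqP; split=> x; last by move=> [C [_ CB] /CB].
  move=> Bx; have : (\bigcup_(C in a) C) x by rewrite ca.
  move=> [C aC Cx]; exists C => //; split=> //.
  by case: (sB C aC) => // CB; have : (C `&` B) x by []; rewrite CB.
have fin_sub a B : Al a -> finite_set [set C | a C /\ C `<=` B].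
  by move=> Ala; have [fa _ _ _] := partAl Ala; apply: sub_finite_set fa => C [].
have mG : G `<=` measurable.
  move=> B [a [Ala sB]]; rewrite (satE a B Ala sB).
  apply: fin_bigcup_measurable; first exact: fin_sub.
  by move=> C [aC _]; have [_ /(_ C aC)[]] := partAl Ala.
have GI : setI_closed G.
  move=> A B [a [Ala sA]] [b [Alb sB]].
  have [c [Alc ac bc]] := (proj2 dirAl) a b Ala Alb.
  have mono a' B' : Al a' -> refines a' c -> sat a' B' -> sat c B'.
    move=> Ala' a'c sB' C cC; have [A' [aA' CA']] := a'c C cC.
    case: (sB' A' aA') => h; first by left; exact: subset_trans h.
    by right; rewrite -subset0 -h; exact: setSI.
  exists c; split=> // C cC.
  case: (mono a A Ala ac sA C cC) => hA; last by right; rewrite setIA hA set0I.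
  case: (mono b B Alb bc sB C cC) => hB; first by left => x Cx; split; [exact: hA|exact: hB].
  by right; rewrite setICA hB setI0.
have [a0 Ala0] := proj1 dirAl.
have GT : G setT by exists a0; split=> // C _; left.
move=> B mB.
apply: (@g_sigma_algebra_measure_unique _ _ _ G mG (fun=> setT) _ _ P Q GI) => //.
- by rewrite bigcup_const //; exists 0%N.
- move=> A [a [Ala sA]].
  have mA : measurable A by apply: mG; exists a.
  suff E : P A = Q A by exact: E.
  rewrite (measE P mA) (measE Q mA); congr EFin.
  have [fa ma ta _] := partAl Ala.
  have fS := fin_sub a A Ala.
  have mS C : [set C | a C /\ C `<=` A] C -> measurable (C : set (mX X)).
    by move=> [/ma[]].
  have tS C D : [set C | a C /\ C `<=` A] C -> [set C | a C /\ C `<=` A] D ->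
      C <> D -> C `&` D = set0 by move=> [aC _] [aD _]; exact: ta.
  rewrite (satE a A Ala sA).
  rewrite (fine_meas_bigcup P fS mS tS) (fine_meas_bigcup Q fS mS tS).
  by apply: eq_fsbigr => C; rewrite inE => -[aC _]; exact: eqPQ aC.
- by move=> _; exact: (le_lt_trans (@probability_le1 _ _ _ P setT measurableT) (ltey _)).
- have : <<s [set A | exists2 a, Al a & a A] >> B by rewrite resAl.
  apply: sub_sigma_algebra2 => A [a Ala aA]; exists a; split=> // C aC.
  have [_ _ ta _] := partAl Ala.
  by have [->|CA] := pselect (C = A); [left|right; exact: ta].
Qed.

Definition open_cyl (C : set (Meas X R)) := exists a W, [/\ Al a, simplex_open a W & C = cyl a W].

Lemma open_cyl_weak_open C : open_cyl C -> weak_open C.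
Proof. by move=> [a [W [Ala oW ->]]]; apply: cyl_weak_open => //; exact: partAl. Qed.

Lemma open_cyl_common C C' : open_cyl C -> open_cyl C' -> exists a W W',
  [/\ Al a, simplex_open a W, simplex_open a W', C = cyl a W & C' = cyl a W'].
Proof.
move=> [a [W [Ala oW ->]]] [b [W' [Alb oW' ->]]].
have [c [Alc ac bc]] := (proj2 dirAl) a b Ala Alb.
have [pa [pb pc]] := (partAl Ala, (partAl Alb, partAl Alc)).
exists c, (transition_preimage (a := a) (b := c) W),
  (transition_preimage (a := b) (b := c) W'); split=> //.
- exact: transition_preimage_open.
- exact: transition_preimage_open.
- exact: cyl_transition.
- exact: cyl_transition.
Qed.

Lemma cylI a (W W' : set (set X -> R)) : cyl a (W `&` W') = cyl a W `&` cyl a W'.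
Proof. by apply/seteqP; split=> P; rewrite /cyl /=; tauto. Qed.

Lemma cylU a (W W' : set (set X -> R)) : cyl a (W `|` W') = cyl a W `|` cyl a W'.
Proof. by apply/seteqP; split=> P; rewrite /cyl /=; tauto. Qed.

Lemma cyl0 a : cyl a set0 = set0 :> set (Meas X R).
Proof. by apply/seteqP; split=> P // []. Qed.

Lemma cylT a : Al a -> cyl a (simplex a) = @M1 X R.
Proof.
move=> Ala; apply/seteqP; split=> P; first by case.
by move=> M1P; split=> //; apply: projM_simplex; exact: partAl.
Qed.

Lemma open_cylI C C' : open_cyl C -> open_cyl C' -> open_cyl (C `&` C').
Proof.
move=> oC oC'; have [a [W [W' [Ala oW oW' -> ->]]]] := open_cyl_common oC oC'.
by exists a, (W `&` W'); rewrite cylI; split=> //; exact: simplex_openI.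
Qed.

Lemma open_cylU C C' : open_cyl C -> open_cyl C' -> open_cyl (C `|` C').
Proof.
move=> oC oC'; have [a [W [W' [Ala oW oW' -> ->]]]] := open_cyl_common oC oC'.
by exists a, (W `|` W'); rewrite cylU; split=> //; exact: simplex_openU.
Qed.

Lemma open_cyl0 : open_cyl set0.
Proof.
have [a Ala] := proj1 dirAl; exists a, set0; by rewrite cyl0; split=> //; exact: simplex_open0.
Qed.

Lemma open_cylT : open_cyl (@M1 X R).
Proof.
have [a Ala] := proj1 dirAl; exists a, (simplex a); by rewrite cylT //; split=> //; exact: simplex_open_full.
Qed.

Lemma open_cyl_lt a (A : set X) (r : R) : Al a -> a A ->
  open_cyl [set P | M1 P /\ fine (P (A : set (mX X))) < r].
Proof.
move=> Ala aA; exists a, [set p | simplex a p /\ p A < r]; split=> //.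
  split; first by move=> p [].
  move=> p [sp pr]; exists (r - p A); split; first by rewrite subr_gt0.
  by move=> q [sq /(_ A aA)]; rewrite ltr_distl => /andP[_ h]; split=> //; lra.
apply/seteqP; split=> P; rewrite /cyl /= /projM mem_set //; last by move=> [? [_ ?]].
by move=> [M1P h]; split=> //; split=> //; apply: projM_simplex; exact: partAl.
Qed.

Lemma open_cyl_gt a (A : set X) (r : R) : Al a -> a A ->
  open_cyl [set P | M1 P /\ r < fine (P (A : set (mX X)))].
Proof.
move=> Ala aA; exists a, [set p | simplex a p /\ r < p A]; split=> //.
  split; first by move=> p [].
  move=> p [sp pr]; exists (p A - r); split; first by rewrite subr_gt0.
  by move=> q [sq /(_ A aA)]; rewrite ltr_distl => /andP[h _]; split=> //; lra.
apply/seteqP; split=> P; rewrite /cyl /= /projM mem_set //; last by move=> [? [_ ?]].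
by move=> [M1P h]; split=> //; split=> //; apply: projM_simplex; exact: partAl.
Qed.

Lemma open_cyl_separate P Q : M1 P -> M1 Q -> ~ same_meas P Q -> exists C C',
  [/\ open_cyl C, open_cyl C', C P, C' Q & C `&` C' = set0].
Proof.
move=> M1P M1Q /partitions_separate[a [A [Ala aA /eqP]]].
rewrite neq_lt => /orP[h|h].
  pose r := (fine (P (A : set (mX X))) + fine (Q (A : set (mX X)))) / 2.
  exists [set P | M1 P /\ fine (P (A : set (mX X))) < r],
    [set P | M1 P /\ r < fine (P (A : set (mX X)))].
  split; [exact: open_cyl_lt aA|exact: open_cyl_gt aA|split=> //|split=> //|].
  - by rewrite /r; lra.
  - by rewrite /r; lra.
  - by rewrite -subset0 => P' [[_ h1] [_ h2]]; have := lt_trans h1 h2; rewrite ltxx.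
pose r := (fine (P (A : set (mX X))) + fine (Q (A : set (mX X)))) / 2.
exists [set P | M1 P /\ r < fine (P (A : set (mX X)))],
  [set P | M1 P /\ fine (P (A : set (mX X))) < r].
split; [exact: open_cyl_gt aA|exact: open_cyl_lt aA|split=> //|split=> //|].
- by rewrite /r; lra.
- by rewrite /r; lra.
- by rewrite -subset0 => P' [[_ h1] [_ h2]]; have := lt_trans h1 h2; rewrite ltxx.
Qed.

(** The classical separation of a point from a compact set, with cylinders as neighbourhoods of the
    point. [K] has to avoid [P] up to [same_meas], because cylinders read Borel sets only. *)
Lemma open_cyl_avoid (K : set (Meas X R)) P : weak_compact K -> M1 P ->
  (forall Q, K Q -> ~ same_meas P Q) ->
  exists C, [/\ open_cyl C, C P & C `&` K = set0].
Proof.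
move=> cK M1P nPK.
have [KM _] := cK.
have [V [[oV [C [oC CP CV]]] KV]] : exists V,
    [set V | weak_open V /\ exists C, [/\ open_cyl C, C P & C `&` V = set0]] V /\ K `<=` V.
  apply: (weak_compact_directed cK).
  - by move=> V [].
  - exists set0; split; first exact: weak_open_set0.
    by exists (@M1 X R); split=> //; [exact: open_cylT|rewrite setI0].
  - move=> V V' [oV [C [oC CP CV]]] [oV' [C' [oC' CP' CV']]].
    exists (V `|` V'); split=> //; split; first exact: weak_openU.
    exists (C `&` C'); split=> //; first exact: open_cylI.
    rewrite setIUr -subset0 => Q [[[CQ C'Q] VQ]|[[CQ C'Q] VQ]].
      by rewrite -CV.
    by rewrite -CV'.
  - move=> Q KQ; have [C [C' [oC oC' CP C'Q CC']]] := open_cyl_separate M1P (KM _ KQ) (nPK _ KQ).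
    by exists C' => //; split; [exact: open_cyl_weak_open|exists C].
by exists C; split=> //; rewrite -subset0 -CV; exact: setIS.
Qed.

Lemma open_cyl_compact (K K' : set (Meas X R)) : weak_compact K -> weak_compact K' ->
  (forall P Q, K P -> K' Q -> ~ same_meas P Q) ->
  exists C, [/\ open_cyl C, K `<=` C & C `&` K' = set0].
Proof.
move=> cK cK' nKK'; have [KM _] := cK.
have [C [[oC CK'] KC]] : exists C, [set C | open_cyl C /\ C `&` K' = set0] C /\ K `<=` C.
  apply: (weak_compact_directed cK).
  - by move=> C [oC _]; exact: open_cyl_weak_open.
  - by exists set0; split; [exact: open_cyl0|rewrite set0I].
  - move=> C C' [oC CK] [oC' CK2]; exists (C `|` C'); split=> //.
    by split; [exact: open_cylU|rewrite setIUl CK CK2 setU0].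
  - move=> P KP; have [C [oC CP CK]] := open_cyl_avoid cK' (KM _ KP) (fun Q => nKK' P Q KP).
    by exists C.
by exists C.
Qed.

Lemma M1_borel_sigma : sigma_algebra (@M1 X R) (@M1_borel X R).
Proof. exact: smallest_sigma_algebra. Qed.

Lemma M1_borel_sub (B : set (Meas X R)) : M1_borel B -> B `<=` @M1 X R.
Proof.
move: B; apply: smallest_sub; last by move=> O [].
by split=> [P []|A _ P []|F hF P [n _ /hF]].
Qed.

Lemma weak_open_borel (O : set (Meas X R)) : weak_open O -> M1_borel O.
Proof. exact: sub_sigma_algebra. Qed.

Lemma cyl_borel a (B : set (set X -> R)) : Al a -> simplex_borel a B -> M1_borel (cyl a B).
Proof.
move=> Ala; move: B; apply: smallest_sub; last first.
  by move=> W oW; apply: weak_open_borel; apply: cyl_weak_open => //; exact: partAl.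
have [s0 sD sU] := M1_borel_sigma; split.
- by rewrite /= cyl0.
- move=> B bB /=; rewrite (_ : cyl a (simplex a `\` B) = @M1 X R `\` cyl a B); first exact: sD.
  apply/seteqP; split=> P [M1P h]; first by split=> //; case: h => _ nB [].
  split=> //; split; first by apply: projM_simplex; exact: partAl.
  by move=> BP; apply: h.
- move=> F hF /=; rewrite (_ : cyl a (\bigcup_n F n) = \bigcup_n cyl a (F n)); first exact: sU.
  apply/seteqP; split=> P; first by move=> [M1P [n _ FnP]]; exists n.
  by move=> [n _ [M1P FnP]]; split=> //; exists n.
Qed.

(** * Comparison of two Radon measures with the same projections *)

Section Uniqueness.
Variable Pia : set (set X) -> set (set X -> R) -> \bar R.

Lemma radon_compact_le (Pi : set (Meas X R) -> \bar R) K B : radon_on_M1 Pi ->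
  M1_borel B -> weak_compact K -> K `<=` B -> (Pi K <= Pi B)%E.
Proof.
move=> [_ rPi] bB cK KB; rewrite (rPi B bB).
by apply: ereal_sup_ubound; exists K.
Qed.

(* The compact sets occurring here need not be Borel, hence the detour through
   inner regularity instead of monotonicity. *)
Lemma radon_le (Pi Pi' : set (Meas X R) -> \bar R) B :
  radon_on_M1 Pi -> radon_on_M1 Pi' -> projects_to Al Pi Pia -> projects_to Al Pi' Pia ->
  M1_borel B -> (Pi B <= Pi' B)%E.
Proof.
move=> rPi rPi' prPi prPi' bB.
have [pPi hPi] := rPi; have [pPi' hPi'] := rPi'.
have sM := M1_borel_sigma; have sub := @M1_borel_sub.
rewrite (hPi B bB); apply: ge_ereal_sup => _ [K [cK KB] <-].
apply/lee_addgt0Pr => e e0.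
have bC := let: And3 _ sD _ := sM in sD _ bB.
have h : ((fine (Pi' (@M1 X R `\` B)) - e)%:E < ereal_sup
    [set Pi' K | K in [set K | weak_compact K /\ K `<=` @M1 X R `\` B]])%E.
  rewrite -hPi' // (prob_on_fin pPi' sM sub bC) lte_fin /=.
  by lra.
have [_ [K' [cK' K'B] <-] hK'] := ereal_sup_gt h.
(* A Borel set contains with a measure all its Radon representatives, so [K] inside [B] and [K']
   outside are disjoint even up to [same_meas]. *)
have [C [oC KC CK']] := open_cyl_compact cK cK' (fun P Q KP K'Q PQ =>
  proj2 (K'B Q K'Q) (M1_borel_same_meas bB PQ (proj1 cK P KP) (proj1 cK' Q K'Q) (KB P KP))).
have bCyl := weak_open_borel (open_cyl_weak_open oC).
have bCC := let: And3 _ sD _ := sM in sD _ bCyl.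
apply: (le_trans (radon_compact_le rPi bCyl cK KC)).
have -> : Pi C = Pi' C.
  have [a [W [Ala oW ->]]] := oC.
  have bW := simplex_open_borel oW.
  by rewrite -(prPi a Ala W bW) -(prPi' a Ala W bW).
have h2 : (Pi' K' <= Pi' (@M1 X R `\` C))%E.
  apply: radon_compact_le => // P K'P; split; first by case: (K'B P K'P).
  by move=> CP; have : (C `&` K') P by []; rewrite CK'.
have := lt_le_trans hK' h2.
rewrite (prob_on_fin pPi' sM sub bCC) lte_fin.
rewrite (prob_on_fineC pPi' sM sub bCyl) (prob_on_fineC pPi' sM sub bB).
rewrite (prob_on_fin pPi' sM sub bCyl) (prob_on_fin pPi' sM sub bB).
by rewrite -EFinD lee_fin; lra.
Qed.

End Uniqueness.

End Cylinders.

(** * Existence and necessity *)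

Section Existence.
Context {X : ptopologicalType} {R : realType}.
Variable Al : set (set (set X)).
Hypotheses (dirAl : directed_refine Al) (resAl : resolves Al).
Hypothesis partAl : forall a, Al a -> finite_borel_partition a.
Variable Pia : set (set X) -> set (set X -> R) -> \bar R.
Hypothesis probPia : forall a, Al a ->
  prob_on (simplex (R := R) a) (simplex_borel (R := R) a) (Pia a).
Hypothesis cohPia : coherent Al Pia.

(** Weak compactness alone does not make a set of representatives closed; together with this
    invariance it does, even in the topology generated by cylinders. *)
Definition saturated (H : set (Meas X R)) :=
  forall P Q, H P -> same_meas P Q -> M1 Q -> H Q.

Hypothesis tightPia : forall e : R, 0 < e -> exists H : set (Meas X R),
  [/\ weak_compact H, saturated H & forall a W, Al a -> simplex_borel a W ->
    H `<=` cyl a W -> 1 - e <= fine (Pia a W)].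

Let sS a := @simplex_borel_sigma X R a.
Let sub a := @simplex_borel_sub X R a.

Let pia_transition a b W : Al a -> Al b -> refines a b -> simplex_open a W ->
  Pia a W = Pia b (transition_preimage (a := a) (b := b) W).
Proof. by move=> Ala Alb ab oW; rewrite (cohPia Ala Alb ab (simplex_open_borel oW)). Qed.

(* Surjectivity of [M1 X -> simplex a] is not needed: by tightness the complement of
   the image carries no mass. *)
Lemma cyl_le_same a (W W' : set (set X -> R)) : Al a -> simplex_open a W ->
  simplex_open a W' -> cyl a W `<=` cyl a W' -> fine (Pia a W) <= fine (Pia a W').
Proof.
move=> Ala oW oW' WW'; have pPia := probPia Ala.
have bW := simplex_open_borel oW; have bW' := simplex_open_borel oW'.
have bD := sigma_on_setD (sS a) (@sub a) bW bW'.
have bDC := let: And3 _ sD _ := sS a in sD _ bD.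
apply/ler_addgt0Pr => e e0; have [H [cH _ tH]] := tightPia e0.
have : 1 - e <= fine (Pia a (simplex a `\` (W `\` W'))).
  apply: tH => // P HP; have M1P : M1 P by case: cH => + _; exact.
  split=> //; split; first exact: projM_simplex (partAl Ala).
  by move=> [WP]; apply; case: (WW' P).
rewrite (prob_on_fineC pPia (sS a) (@sub a) bD) => h.
have h2 : fine (Pia a W) <= fine (Pia a (W' `|` (W `\` W'))).
  apply: (le_prob_on_fine pPia (sS a) (@sub a)) => //.
    exact: (sigma_on_setU (sS a)).
  by move=> p Wp; have [|] := pselect (W' p); [left|right].
rewrite (prob_on_fineU pPia (sS a) (@sub a) bW' bD (setDIK _ _)) in h2.
by lra.
Qed.

(** A cylinder has many bases over many partitions; [xget] picks one value, and [cyl_contentE] shows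
    that all of them agree. *)
Definition cyl_content (C : set (Meas X R)) : R := xget 0
  [set r | exists a W, [/\ Al a, simplex_open a W, C = cyl a W & r = fine (Pia a W)]].

Lemma cyl_le a b (W W' : set (set X -> R)) : Al a -> Al b -> simplex_open a W ->
  simplex_open b W' -> cyl a W `<=` cyl b W' -> fine (Pia a W) <= fine (Pia b W').
Proof.
move=> Ala Alb oW oW'; have [c [Alc ac bc]] := (proj2 dirAl) a b Ala Alb.
have [pa [pb pc]] := (partAl Ala, (partAl Alb, partAl Alc)).
rewrite (cyl_transition pa pc ac) (cyl_transition pb pc bc).
rewrite (pia_transition Ala Alc ac oW) (pia_transition Alb Alc bc oW').
by apply: cyl_le_same => //; exact: transition_preimage_open.
Qed.

Lemma cyl_contentE a W : Al a -> simplex_open a W -> cyl_content (cyl a W) = fine (Pia a W).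
Proof.
move=> Ala oW; rewrite /cyl_content; case: xgetP => [r _|/(_ (fine (Pia a W)))[]].
  move=> [b [W' [Alb oW' E ->]]]; apply/eqP; rewrite eq_le.
  by apply/andP; split; apply: cyl_le => //; rewrite E.
by exists a, W.
Qed.

Let M1_cyl a : Al a -> @M1 X R = cyl a (simplex a).
Proof. by move=> Ala; rewrite (cylT partAl). Qed.

Lemma cyl_content_modular C C' : open_cyl Al C -> open_cyl Al C' ->
  cyl_content (C `|` C') + cyl_content (C `&` C') = cyl_content C + cyl_content C'.
Proof.
move=> oC oC'; have [a [W [W' [Ala oW oW' -> ->]]]] := open_cyl_common dirAl partAl oC oC'.
rewrite -cylU -cylI !cyl_contentE //; [|exact: simplex_openI|exact: simplex_openU].
by apply: (prob_on_fine_modular (probPia Ala) (sS a) (@sub a)); exact: simplex_open_borel.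
Qed.

(** An open subset of the metric simplex is exhausted by closed sets, and the complement of a late
    one is the base of [V]. *)
Lemma cyl_content_approx C (e : R) : open_cyl Al C -> 0 < e -> exists V,
  [/\ open_cyl Al V, V `|` C = @M1 X R & cyl_content C + cyl_content V <= 1 + e].
Proof.
move=> [a [W [Ala oW ->]]] e0; have [fa _ _ _] := partAl Ala.
have oV n : simplex_open a (simplex a `\` simplex_inner a W n) by exact: simplex_inner_open.
have VE n : simplex_inner a W n = simplex a `\` (simplex a `\` simplex_inner a W n).
  by rewrite setDD setIC setIidl // => p [].
have bV n : simplex_borel a (simplex_inner a W n).
  rewrite VE; have [_ sD _] := sS a; apply: sD; exact: simplex_open_borel.
have [n] := prob_on_approx (probPia Ala) (sS a) (@sub a) bV (@simplex_inner_homo X R a W) e0.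
rewrite simplex_inner_bigcup // => hn.
exists (cyl a (simplex a `\` simplex_inner a W n)); split.
- by exists a, (simplex a `\` simplex_inner a W n).
- rewrite -cylU (M1_cyl Ala); congr (cyl a _); apply/seteqP; split=> p.
    by move=> [[]//|/(simplex_open_sub oW)].
  move=> sp; have [Vp|nVp] := pselect (simplex_inner a W n p); last by left.
  by right; rewrite -(simplex_inner_bigcup fa oW); exists n.
- rewrite !cyl_contentE //.
  by rewrite (prob_on_fineC (probPia Ala) (sS a) (@sub a)) //; lra.
Qed.

Lemma directed_compact_sub (T : Type) (G G' : set (set T)) (H : set T) :
  G `<=` G' -> directed_compact G' H -> directed_compact G H.
Proof. by move=> GG' cH F FG; apply: cH; exact: subset_trans GG'. Qed.

Theorem exists_radon_projective_limit :
  exists Pi : set (Meas X R) -> \bar R, radon_on_M1 Pi /\ projects_to Al Pi Pia.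
Proof.
pose U := @open_cyl X R Al.
have [a0 Ala0] := proj1 dirAl.
have U_sub C : U C -> C `<=` @M1 X R by move=> [a [W [_ _ ->]]] P [].
have nu_ge0 C : U C -> 0 <= cyl_content C.
  move=> [a [W [Ala oW ->]]]; rewrite cyl_contentE //.
  by apply: (prob_on_fine_ge0 (probPia Ala)); exact: simplex_open_borel.
have nu0 : cyl_content set0 = 0.
  rewrite -(cyl0 a0) cyl_contentE; [|exact: Ala0|exact: simplex_open0].
  by rewrite (prob_on_set0 (probPia Ala0)).
have nuM : cyl_content (@M1 X R) = 1.
  rewrite (M1_cyl Ala0) cyl_contentE; [|exact: Ala0|exact: simplex_open_full].
  by rewrite (prob_on_full (probPia Ala0)).
have le_nu C C' : U C -> U C' -> C `<=` C' -> cyl_content C <= cyl_content C'.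
  move=> [a [W [Ala oW ->]]] [b [W' [Alb oW' ->]]] CC'.
  by rewrite !cyl_contentE //; exact: cyl_le.
have nu_tight (e : R) : 0 < e -> exists H : set (Meas X R),
    [/\ weak_compact H, saturated H & nearly_full (U := U) (nu := cyl_content) e H].
  move=> e0; have [H [cH sH tH]] := tightPia e0; exists H; split=> //.
  move=> C [a [W [Ala oW ->]]] HC; rewrite cyl_contentE //; apply: tH => //.
  exact: simplex_open_borel.
have [mu [muM0 muU mu_outer mu_open [mu_tight mu01]]] :=
  lattice_content_extension U_sub (open_cyl0 dirAl) (open_cylT dirAl partAl)
    (open_cylI dirAl partAl) (open_cylU dirAl partAl) nu_ge0 nu0 nuM le_nu
    cyl_content_modular cyl_content_approx
    (fun e e0 => let: ex_intro H (And3 cH _ tH) := nu_tight e e0 in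
       ex_intro _ H (And3 (proj1 cH) (directed_compact_sub
         (open_cyl_weak_open partAl) (weak_compact_directed cH)) tH)).
have union_weak_open O : union_open (M := @M1 X R) (U := U) O -> weak_open O.
  move=> [OM oO]; rewrite (_ : O = \bigcup_(C in [set C | U C /\ C `<=` O]) C); last first.
    apply/seteqP; split=> P; last by move=> [C [_ CO] /CO].
    by move=> /oO[C [UC CP CO]]; exists C.
  by apply: weak_open_bigcup => C [/(open_cyl_weak_open partAl)].
(* Saturation turns [P] not in [K] into [P] not represented in [K], as separation by cylinders
   demands. *)
have compact_open K : weak_compact K -> saturated K ->
    union_open (M := @M1 X R) (U := U) (@M1 X R `\` K).
  move=> cK sK; split; first by move=> P [].
  move=> P [M1P nKP].
  have [|C [oC CP CK]] := open_cyl_avoid dirAl resAl partAl cK M1P.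
    by move=> Q KQ PQ; apply: nKP; apply: (sK Q) => //; exact: same_meas_sym.
  exists C; split=> // Q CQ; split; first exact: U_sub CQ.
  by move=> KQ; have : (C `&` K) Q by []; rewrite CK.
(* The set [H] minus [O] is compact, so its complement [G] in [M1] is a union of cylinders and
   measurable. [G] contains [O] and differs from it only off [H], by a set of mass at most [e]. *)
have weak_cara O : weak_open O -> mu.-caratheodory O.
  move=> oO; apply: le_caratheodory_measurable => Y.
  apply/lee_addgt0Pr => e e0; have [H [cH sH tH]] := nu_tight e e0.
  have cK := weak_compactD cH oO.
  have sK : saturated (H `\` O).
    move=> P Q [HP nOP] PQ M1Q; split; first exact: sH PQ M1Q.
    move=> OQ; apply: nOP; apply: (weak_open_same_meas oO) OQ; first exact: same_meas_sym.
    exact: (proj1 cH).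
  have oG := compact_open _ cK sK.
  set G := @M1 X R `\` (H `\` O) in oG.
  rewrite (mu_open G oG Y) -addeA; apply: leeD.
    apply: le_outer_measure; apply: setIS => P OP; split; first exact: weak_open_sub OP.
    by move=> [].
  apply: (@le_trans _ _ (mu ((Y `&` ~` G) `|` ((@M1 X R `\` H) `|` ~` @M1 X R)))).
    apply: le_outer_measure => P [YP nOP].
    have [M1P|nM1] := pselect (M1 P); last by right; right.
    have [HP|nHP] := pselect (H P); last by right; left.
    by left; split=> // -[_]; apply.
  apply: (le_trans (outer_measureU2 _ _ _)); apply: leeD2l.
  apply: (le_trans (outer_measureU2 _ _ _)); rewrite muM0 adde0.
  by apply: mu_tight => //; [exact: (proj1 cH)|exact: compact_open].
have M1_cara : mu.-caratheodory (@M1 X R) by apply: weak_cara; exact: weak_open_M1.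
have borel_cara B : M1_borel B -> mu.-caratheodory B.
  move: B; apply: smallest_sub => //; split.
  - exact: caratheodory_measurable_set0.
  - by move=> A cA; exact: caratheodory_measurable_setD.
  - by move=> F cF; exact: caratheodory_measurable_bigcup.
have pmu : prob_on (@M1 X R) (@M1_borel X R) mu.
  split; [exact: outer_measure0|by move=> A _; exact: outer_measure_ge0| |].
  - move=> F bF tF; apply: caratheodory_measure_sigma_additive => //.
      by move=> n; exact: borel_cara.
    by apply: caratheodory_measurable_bigcup => n; exact: borel_cara.
  - by rewrite muU ?nuM //; exact: open_cylT.
have sM := @M1_borel_sigma X R; have subM := @M1_borel_sub X R.
exists mu; split; first split=> //.
- move=> B bB; apply/eqP; rewrite eq_le; apply/andP; split; last first.
    by apply: ge_ereal_sup => _ [K [_ KB] <-]; exact: le_outer_measure.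
  apply/lee_addgt0Pr => e e0; have e2 : 0 < e / 2 by lra.
  have bC : M1_borel (@M1 X R `\` B) by have [_ sD _] := sM; exact: sD.
  (* Outer regularity of the complement becomes inner regularity of [B]: [H] minus [G] is compact,
     lies in [B] and misses at most [e] of its mass, half through [G] and half through [H]. *)
  have [G [oG BG hG]] := mu_outer (@M1 X R `\` B) (e / 2) e2.
  have [H [cH sH tH]] := nu_tight (e / 2) e2.
  have cK := weak_compactD cH (union_weak_open G oG).
  have hK : (mu (H `\` G) <= ereal_sup
      [set mu K | K in [set K | weak_compact K /\ K `<=` B]])%E.
    apply: ereal_sup_ubound; exists (H `\` G) => //; split=> // P [HP nGP].
    apply: contrapT => nBP; apply: nGP; apply: BG.
    have M1P : M1 P by exact: (proj1 cH).
    by split=> //; split.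
  apply: (le_trans _ (leeD2r _ hK)).
  have h1 : (mu (@M1 X R) <= mu (H `\` G) + (mu G + mu (@M1 X R `\` H)))%E.
    apply: (@le_trans _ _ (mu ((H `\` G) `|` (G `|` (@M1 X R `\` H))))).
      apply: le_outer_measure => P M1P.
      have [GP|nGP] := pselect (G P); first by right; left.
      by have [HP|nHP] := pselect (H P); [left|right; right].
    apply: (le_trans (outer_measureU2 _ _ _)); apply: leeD2l.
    exact: outer_measureU2.
  have h2 : (mu (@M1 X R `\` H) <= (e / 2)%:E)%E.
    by apply: mu_tight => //; [exact: (proj1 cH)|exact: compact_open].
  have fin Y : mu Y = (fine (mu Y))%:E by have /andP[] := mu01 Y; exact: ereal_fin_bounds.
  move: h1 h2 hG; rewrite (prob_on_full pmu) (fin (H `\` G)) (fin G) (fin (_ `\` H)).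
  rewrite (fin (_ `\` B)) (prob_on_fineC pmu sM subM bB) (fin B) -!EFinD !lee_fin.
  by lra.
- move=> a Ala B bB.
  have bcyl B' : simplex_borel a B' -> M1_borel (cyl a B') by exact: (cyl_borel partAl).
  (* Agreement with [Pia a] is known on the open sets of the simplex, an intersection-stable
     generator of its Borel sets. *)
  pose nu B' := mu (cyl a B').
  have pnu : prob_on (simplex (R := R) a) (simplex_borel (R := R) a) nu.
    split.
    - by rewrite /nu cyl0; exact: outer_measure0.
    - by move=> A _; exact: outer_measure_ge0.
    - move=> F bF tF; rewrite /nu.
      have -> : cyl a (\bigcup_n F n) = \bigcup_n cyl a (F n).
        apply/seteqP; split=> P; first by move=> [M1P [n _ FnP]]; exists n.
        by move=> [n _ [M1P FnP]]; split=> //; exists n.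
      case: pmu => _ _ + _; apply; first by move=> n; exact: bcyl.
      by move=> n m _ _ [P [[_ Fn] [_ Fm]]]; apply: tF => //; exists (projM a P).
    - by rewrite /nu (cylT partAl) //; case: pmu.
  apply: (@prob_on_unique _ _ (simplex a) (simplex_open a) _ _ _ _ (probPia Ala) pnu) => //.
  + by move=> A [].
  + by move=> A A'; exact: simplex_openI.
  + move=> W oW; rewrite /nu muU; last by exists a, W.
    rewrite cyl_contentE // -(prob_on_fin (probPia Ala) (sS a) (@sub a)) //.
    exact: simplex_open_borel.
Qed.

End Existence.

(** * A dominating measure extracted from a Radon limit *)

Section Necessity.
Context {X : ptopologicalType} {R : realType}.
Hypothesis hX : hausdorff_space X.
Variable Al : set (set (set X)).
Hypothesis partAl : forall a, Al a -> finite_borel_partition a.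
Variable Pia : set (set X) -> set (set X -> R) -> \bar R.

Lemma radon_tight (Pi : set (Meas X R) -> \bar R) (e : R) : radon_on_M1 Pi -> 0 < e ->
  exists K, weak_compact K /\ ((1 - e)%:E < Pi K)%E.
Proof.
move=> [pPi rPi] e0.
have h : ((1 - e)%:E < ereal_sup
    [set Pi K | K in [set K | weak_compact K /\ K `<=` @M1 X R]])%E.
  rewrite -rPi ?(prob_on_full pPi) ?lte_fin; first by lra.
  by apply: weak_open_borel; exact: weak_open_M1.
by have [_ [K [cK _] <-] hK] := ereal_sup_gt h; exists K.
Qed.

Lemma radon_dominated (Pi : set (Meas X R) -> \bar R) : radon_on_M1 Pi ->
  projects_to Al Pi Pia ->
  exists Q : Meas X R, M1 Q /\ forall eps delta : R, 0 < eps -> 0 < delta ->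
    exists L : R, 0 < L /\ forall a, Al a ->
      (Pia a [set p | simplex (R:=R) a p /\ (delta < l1_excess a L p (projM a Q))%R]
       < eps%:E)%E.
Proof.
move=> rPi prPi; have [pPi _] := rPi.
(* Total mass one forces [M1] to be inhabited; [Q0] seeds the recursion behind
   [weak_compact_uniform_ac]. *)
have [Q0 M1Q0] : exists Q0, @M1 X R Q0.
  apply: contrapT => no; have := prob_on_full pPi.
  have -> : @M1 X R = set0 by rewrite -subset0 => P M1P; apply: no; exists P.
  by rewrite (prob_on_set0 pPi) => /eqP; rewrite eq_sym onee_eq0.
have half_gt0 n : 0 < 2 ^- n :> R by rewrite invr_gt0 exprn_gt0.
have /choice[K hK] : forall n, exists K, weak_compact K /\ ((1 - 2 ^- n)%:E < Pi K)%E.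
  by move=> n; exact: radon_tight.
have /choice[Qd hQd] : forall n, exists Qd : Meas X R * R, [/\ M1 Qd.1, 0 < Qd.2 &
    forall P (B : set (mX X)), K n P -> measurable B -> fine (Qd.1 B) < Qd.2 ->
      fine (P B) < 2 ^- n].
  move=> n; have [Q [d [M1Q d0 h]]] :=
    weak_compact_uniform_ac hX (proj1 (hK n)) M1Q0 (half_gt0 n).
  by exists (Q, d).
have [Q [M1Q hQ]] := @exists_M1_mixture X R hX (fun n => (Qd n).1)
  (fun n => let: And3 h _ _ := hQd n in h).
exists Q; split=> // eps delta eps0 delta0.
(* One index serves both purposes: [2^-n] bounds the mass outside [K n] against [eps] and the excess
   on [K n] against [delta]. *)
have [n hn] : exists n, 2 ^- n < Num.min eps delta.
  by apply: half_pow_lt; rewrite lt_min eps0.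
have [neps ndelta] : 2 ^- n < eps /\ 2 ^- n < delta.
  by move: hn; rewrite lt_min => /andP.
have [_ d0 hac] := hQd n.
(* The weight of the [n]-th measure in the mixture is [2^-(n+1)], so its threshold shrinks by that
   factor when expressed through [Q]. *)
pose d := (Qd n).2 / 2 ^+ n.+1.
have d'0 : 0 < d by rewrite divr_gt0 // exprn_gt0.
exists (1 / d + 1); split; first by rewrite addr_gt0 // divr_gt0.
move=> a Ala; have pa := partAl Ala; have [fa _ _ _] := pa.
have oS := @l1_excess_open X R a delta (1 / d + 1) (projM a Q) fa.
rewrite (prPi a Ala _ (simplex_open_borel oS)).
set S := [set P | _].
have bS : M1_borel S by apply: weak_open_borel; exact: cyl_weak_open oS.
have bSC : M1_borel (@M1 X R `\` S) by have [_ sD _] := @M1_borel_sigma X R; exact: sD.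
have KS : K n `<=` @M1 X R `\` S.
  move=> P KP; split; first exact: (proj1 (proj1 (hK n))).
  move=> [_ [_ hP]].
  have : l1_excess a (1 / d + 1) (projM a P) (projM a Q) < 2 ^- n.
    apply: (@l1_excess_lt X R a P Q d) => //; last by rewrite ltrDl.
    move=> B mB QB; apply: hac => //; apply: (le_lt_trans (hQ n B mB)).
    by rewrite -ltr_pdivlMl ?exprn_gt0 // mulrC.
  by move=> h; have := lt_trans hP (lt_trans h ndelta); rewrite ltxx.
have := lt_le_trans (proj2 (hK n)) (radon_compact_le rPi bSC (proj1 (hK n)) KS).
have sM := @M1_borel_sigma X R; have subM := @M1_borel_sub X R.
rewrite (prob_on_fin pPi sM subM bSC) (prob_on_fineC pPi sM subM bS).
rewrite (prob_on_fin pPi sM subM bS) !lte_fin.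
by lra.
Qed.

End Necessity.

Theorem mainTheorem6 (X : ptopologicalType) (R : realType)
  (Al : set (set (set X)))
  (Pia : set (set X) -> set (set X -> R) -> \bar R) :
  hausdorff_space X ->
  minimal_conditions R Al ->
  resolves Al ->
  (forall a, Al a -> prob_on (simplex (R:=R) a) (simplex_borel (R:=R) a) (Pia a)) ->
  coherent Al Pia ->
  ((exists Pi : set (Meas X R) -> \bar R,
      [/\ radon_on_M1 Pi, projects_to Al Pi Pia &
          forall Pi' : set (Meas X R) -> \bar R,
            radon_on_M1 Pi' -> projects_to Al Pi' Pia ->
            forall B, M1_borel B -> Pi' B = Pi B]) <->
   (exists Q : Meas X R, M1 (R:=R) Q /\
      forall eps delta : R, 0 < eps -> 0 < delta ->
        exists L : R, 0 < L /\
          forall a, Al a ->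
            (Pia a [set p | simplex (R:=R) a p /\
                            (delta < l1_excess a L p (projM a Q))%R] < eps%:E)%E)).
Proof.
move=> hX [_ _ dirAl partAl _] resAl probPia cohPia; split.
  by move=> [Pi [rPi prPi _]]; exact: radon_dominated prPi.
move=> [Q [M1Q hQ]].
have tight (e : R) : 0 < e -> exists H : set (Meas X R),
    [/\ weak_compact H, saturated H & forall a W, Al a -> simplex_borel a W ->
      H `<=` cyl a W -> 1 - e <= fine (Pia a W)].
  move=> e0.
  have half_gt0 n : 0 < 2 ^- n :> R by rewrite invr_gt0 exprn_gt0.
  have /choice[L hL] := fun n => hQ _ _ (mulr_gt0 e0 (half_gt0 n.+1)) (half_gt0 n).
  have L_gt0 n : 0 < L n by case: (hL n).
  exists (dominated Q L); split.
  - exact: dominated_weak_compact.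
  - move=> P P' [_ dP] PP' M1P'; split=> // n B mB.
    by rewrite -(PP' B mB); exact: dP.
  - move=> a W Ala bW HW.
    apply: (@dominated_tight X R hX Q L M1Q L_gt0 a (Pia a) W e) => //.
    + exact: partAl.
    + exact: probPia.
    + by move=> n; case: (hL n) => _ /(_ a Ala).
have [Pi [rPi prPi]] := exists_radon_projective_limit dirAl resAl partAl probPia cohPia tight.
exists Pi; split=> // Pi' rPi' prPi' B bB.
by apply/eqP; rewrite eq_le !(@radon_le X R Al dirAl resAl partAl Pia).
Qed.
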